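(* The variety of complex $3$-dimensional associative superalgebras of type $(2,1)$ has dimension $5$ and has exactly $13$ irreducible components, namely $\overline{\mathcal{O}(\mathbf{R}_{k})}$ for $k\in\{01,03,04,05,07,23,25,26,29,31,32,33,36\}$. In particular, exactly $13$ superalgebras are rigid in this variety.
   Context: All algebras are over $\mathbb{C}$. A superalgebra is a $\mathbb{Z}_2$-graded algebra $A=A_0\oplus A_1$ with $A_iA_j\subseteq A_{i+j \bmod 2}$; $|x|\in\{0,1\}$ is the degree of a homogeneous $x$. It has type $(n,m)$ if $\dim A_0=n$, $\dim A_1=m$. The associator is $(x,y,z)=(xy)z-x(yz)$; a superalgebra is associative if $(x,y,z)=0$ for all $x,y,z$. Geometric setting: fix a graded space $V=V_0\oplus V_1$ of type $(n,m)$ with a homogeneous basis. Superalgebra structures on $V$ are even bilinear maps $\mu:V\times V\to V$, identified with their structure constants; those satisfying a given family of graded polynomial identities form a Zariski-closed subset (an affine variety) of this affine space. The group $GL(V_0)\times GL(V_1)$ acts by $(g*\mu)(x,y)=g\mu(g^{-1}x,g^{-1}y)$; its orbits are the isomorphism classes. $\mathcal{O}(A)$ denotes the orbit of (a structure representing) $A$ and $\overline{\mathcal{O}(A)}$ its Zariski closure. A superalgebra is rigid if its orbit is open in the variety. The dimension of the variety is the maximal dimension of its irreducible components. Superalgebras of type $(2,1)$, in basis $e_1,e_2$ (even), $f_1$ (odd), listed by nonzero products (unlisted products are zero): $\mathbf{R}_{01}$: $e_1e_1=e_1,\ e_2e_2=e_2$; $\mathbf{R}_{03}$: $e_1e_1=e_1,\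 e_2e_2=e_2,\ e_1f_1=f_1,\ f_1e_1=f_1,\ f_1f_1=e_1$; $\mathbf{R}_{04}$: $e_1e_1=e_1,\ e_2e_2=e_2,\ f_1e_1=f_1$; $\mathbf{R}_{05}$: $e_1e_1=e_1,\ e_2e_2=e_2,\ e_1f_1=f_1$; $\mathbf{R}_{07}$: $e_1e_1=e_1,\ e_2e_2=e_2,\ e_2f_1=f_1,\ f_1e_1=f_1$; $\mathbf{R}_{23}$: $e_1e_1=e_1,\ e_1e_2=e_2$; $\mathbf{R}_{25}$: $e_1e_1=e_1,\ e_2e_1=e_2$; $\mathbf{R}_{26}$: $e_1e_1=e_1,\ e_2e_1=e_2,\ e_1f_1=f_1$; $\mathbf{R}_{29}$: $e_1e_1=e_1,\ e_1e_2=e_2,\ f_1e_1=f_1$; $\mathbf{R}_{31}$: $e_1e_1=e_1,\ e_2e_1=e_2,\ f_1e_1=f_1$; $\mathbf{R}_{32}$: $e_1e_1=e_1,\ e_1e_2=e_2,\ e_1f_1=f_1$; $\mathbf{R}_{33}$: $e_1e_1=e_1,\ e_2e_1=e_2,\ e_1f_1=f_1,\ f_1e_1=f_1$; $\mathbf{R}_{36}$: $e_1e_1=e_1,\ e_1e_2=e_2,\ e_1f_1=f_1,\ f_1e_1=f_1$. *)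

(* Defs.v *)
From HB Require Import structures.
From mathcomp Require Import all_boot all_order all_algebra.
From mathcomp Require Import complex.
From mathcomp Require Import Rstruct.
Set Implicit Arguments. Unset Strict Implicit. Unset Printing Implicit Defensive.
Import Order.TTheory GRing.Theory Num.Theory.
Local Open Scope ring_scope.

Definition CC : numClosedFieldType := (Rdefinitions.R)[i].

(* Graded space V = V_0 (+) V_1 of type (2,1) with homogeneous basis
   b_0 = e_1, b_1 = e_2 (even), b_2 = f_1 (odd). *)
Definition deg (i : 'I_3) : bool := (i == 2 :> nat).

(* A bilinear map mu : V x V -> V, identified with its structure constants:
   mu i j k = coefficient of b_k in mu(b_i, b_j). *)
Definition struct := 'I_3 -> 'I_3 -> 'I_3 -> CC.

Definition even_str (mu : struct) : Prop :=
  forall i j k : 'I_3, (deg i (+) deg j) != deg k -> mu i j k = 0.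

Definition assoc_str (mu : struct) : Prop :=
  forall i j l m : 'I_3,
    \sum_(k < 3) mu i j k * mu k l m = \sum_(k < 3) mu j l k * mu i k m.

Definition pset := struct -> Prop.
Definition subset_ (A B : pset) : Prop := forall x, A x -> B x.
Definition seteq_ (A B : pset) : Prop := forall x, A x <-> B x.

Definition AssSupVar : pset := fun mu => even_str mu /\ assoc_str mu.

Inductive polyfun : (struct -> CC) -> Prop :=
| pf_const (c : CC) : polyfun (fun _ => c)
| pf_coord (i j k : 'I_3) : polyfun (fun mu => mu i j k)
| pf_add f g : polyfun f -> polyfun g -> polyfun (fun mu => f mu + g mu)
| pf_mul f g : polyfun f -> polyfun g -> polyfun (fun mu => f mu * g mu).

Definition zclosed (Z : pset) : Prop :=
  exists P : (struct -> CC) -> Prop,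
    (forall f, P f -> polyfun f) /\ seteq_ Z (fun mu => forall f, P f -> f mu = 0).

Definition rel_closed (X Z : pset) : Prop :=
  exists W, zclosed W /\ seteq_ Z (fun mu => X mu /\ W mu).

Definition closure_in (X S : pset) : pset :=
  fun mu => X mu /\ forall Z, rel_closed X Z -> subset_ S Z -> Z mu.

Definition zirreducible (Y : pset) : Prop :=
  (exists mu, Y mu) /\
  forall Z1 Z2, zclosed Z1 -> zclosed Z2 ->
    subset_ Y (fun mu => Z1 mu \/ Z2 mu) -> subset_ Y Z1 \/ subset_ Y Z2.

Definition zirr_component (X Y : pset) : Prop :=
  subset_ Y X /\ zirreducible Y /\
  forall Y', subset_ Y Y' -> subset_ Y' X -> zirreducible Y' -> subset_ Y' Y.

Definition irr_chain (X : pset) (n : nat) : Prop :=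
  exists Z : nat -> pset,
    (forall k, (k <= n)%N -> rel_closed X (Z k) /\ zirreducible (Z k)) /\
    (forall k, (k < n)%N -> subset_ (Z k) (Z k.+1) /\
                             exists mu, Z k.+1 mu /\ ~ Z k mu).

Definition has_dim (X : pset) (n : nat) : Prop :=
  irr_chain X n /\ ~ irr_chain X n.+1.

Definition grGL (g : 'M[CC]_3) : Prop :=
  g \in unitmx /\ forall i j : 'I_3, deg i != deg j -> g i j = 0.

(* (g * mu)(x, y) = g mu(g^-1 x, g^-1 y), coordinates as column vectors *)
Definition act (g : 'M[CC]_3) (mu : struct) : struct :=
  fun i j k => let h := invmx g in
    \sum_(a < 3) \sum_(b < 3) \sum_(c < 3) h a i * h b j * mu a b c * g k c.

Definition sorbit (mu : struct) : pset :=
  fun nu => exists g, grGL g /\ forall i j k, nu i j k = act g mu i j k.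

Definition zrigid (X : pset) (mu : struct) : Prop :=
  exists W, zclosed W /\ seteq_ (sorbit mu) (fun nu => X nu /\ ~ W nu).

Definition mkstr (l : seq (nat * nat * nat)) : struct :=
  fun i j k => if ((i : nat), (j : nat), (k : nat)) \in l then 1 else 0.

Definition Rtable : seq (seq (nat * nat * nat)) :=
  [:: [:: (0,0,0); (1,1,1)]%N;                                  (* R01 *)
      [:: (0,0,0); (1,1,1); (0,2,2); (2,0,2); (2,2,0)]%N;        (* R03 *)
      [:: (0,0,0); (1,1,1); (2,0,2)]%N;                          (* R04 *)
      [:: (0,0,0); (1,1,1); (0,2,2)]%N;                          (* R05 *)
      [:: (0,0,0); (1,1,1); (1,2,2); (2,0,2)]%N;                 (* R07 *)
      [:: (0,0,0); (0,1,1)]%N;                                  (* R23 *)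
      [:: (0,0,0); (1,0,1)]%N;                                  (* R25 *)
      [:: (0,0,0); (1,0,1); (0,2,2)]%N;                          (* R26 *)
      [:: (0,0,0); (0,1,1); (2,0,2)]%N;                          (* R29 *)
      [:: (0,0,0); (1,0,1); (2,0,2)]%N;                          (* R31 *)
      [:: (0,0,0); (0,1,1); (0,2,2)]%N;                          (* R32 *)
      [:: (0,0,0); (1,0,1); (0,2,2); (2,0,2)]%N;                 (* R33 *)
      [:: (0,0,0); (0,1,1); (0,2,2); (2,0,2)]%N ].               (* R36 *)

Definition Ralg (n : 'I_13) : struct := mkstr (nth [::] Rtable n).

(* Main.v *)
(* Writing e_i f = l_i f, f e_i = r_i f, f f = s, a structure of type (2,1) consists of an associative
   even part, two characters l, r of it (possibly zero) and a vector s. A noncommutative even part is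
   x y = phi(x) y or x y = phi(y) x; then l and r are 0 or phi and s = 0, which gives eight planes.
   Commutative even parts form a determinantal variety with a polynomial parametrization that also
   exhibits the two characters, so the remaining points form five further images of affine spaces.
   The variety is therefore the union of thirteen images of polynomial maps; each is irreducible, its
   generic points form the orbit of one R_k, and the R_k are separated by explicit equations.

   For the dimension, a chain Z_0 < ... < Z_6 of irreducible closed sets yields six algebraically
   independent polynomials on Z_6: to independent f_1, ..., f_k on Z_k add any g vanishing on Z_k but
   not on Z_(k+1). Each family depends on five parameters up to rescaling, and six polynomials in five
   variables are algebraically dependent by counting monomials. *)
Require Import Defs.
From mathcomp Require Import all_boot all_order all_algebra.
From mathcomp Require Import ring zify.
From Stdlib Require Import Classical FunctionalExtensionality.
Set Implicit Arguments. Unset Strict Implicit. Unset Printing Implicit Defensive.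
Import Order.TTheory GRing.Theory Num.Theory.
Local Open Scope ring_scope.

(* Otherwise [/=] unfolds [CC] and the canonical structures are no longer found. *)
Arguments Num.ClosedField.sort : simpl never.

(** * Polynomial functions on structures and on parameter spaces *)

(** No classification up to isomorphism is made, and no degeneration is exhibited: each family
    contains its degenerate points as well, and density of one orbit in its image follows because a
    product of two nonzero polynomial functions is nonzero. The count is 5 + 8. Over a commutative
    even part each of l, r is 0, L or L', where L and L' are its two characters; up to exchanging
    these, (l, r) is (0,0), (L,L), (0,L), (L,0) or (L',L), and a nonzero s forces l = r. A
    noncommutative even part has two possible multiplications, each with four choices of l, r in {0,
    phi}. Since the dimension is defined by chains, the upper bound is obtained with polynomial
    functions alone, without coordinate rings. The lower bound needs a chain of length 5; it is a
    flag of specializations of the family of R_03, the only one in which the parameter c of the odd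
    square is active. *)

Definition env := nat -> CC.

Inductive pol : (env -> CC) -> Prop :=
| pol_const (c : CC) : pol (fun _ => c)
| pol_var (i : nat) : pol (fun t => t i)
| pol_add F G : pol F -> pol G -> pol (fun t => F t + G t)
| pol_mul F G : pol F -> pol G -> pol (fun t => F t * G t).

Definition polmap (Phi : env -> struct) :=
  forall i j k, pol (fun t => Phi t i j k).

Lemma pol_comp f Phi : polyfun f -> polmap Phi -> pol (f \o Phi).
Proof.
move=> pf hPhi; elim: pf => /= [c|i j k|g h _ IHg _ IHh|g h _ IHg _ IHh].
- exact: pol_const.
- exact: hPhi.
- exact: pol_add IHg IHh.
- exact: pol_mul IHg IHh.
Qed.

Lemma pol_opp F : pol F -> pol (fun t => - F t).
Proof.
move=> pF; have -> : (fun t => - F t) = (fun t => -1 * F t).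
  by apply: functional_extensionality => t; rewrite mulN1r.
exact: pol_mul (pol_const _) pF.
Qed.

(** On the line through [a] (z = 0) and [b] (z = 1) a polynomial function becomes univariate, and
    [{poly CC}] is an integral domain. *)
Lemma pol_line F (a b : env) : pol F ->
  exists p : {poly CC}, forall z, F (fun i => a i + z * (b i - a i)) = p.[z].
Proof.
elim=> [c|i|G H _ [p hp] _ [q hq]|G H _ [p hp] _ [q hq]].
- by exists c%:P => z; rewrite hornerC.
- by exists ((a i)%:P + 'X * (b i - a i)%:P) => z; rewrite !hornerE.
- by exists (p + q) => z; rewrite hornerD hp hq.
- by exists (p * q) => z; rewrite hornerM hp hq.
Qed.

Lemma poly_fun_eq0 (p : {poly CC}) : (forall z, p.[z] = 0) -> p = 0.
Proof.
move=> hp; apply/eqP; apply: contraT => p0.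
have := max_poly_roots (rs := [seq i%:R : CC | i <- iota 0 (size p)]) p0.
rewrite size_map size_iota ltnn => -> //.
- by apply/allP => z _; apply/rootP.
- by rewrite map_inj_uniq ?iota_uniq // => i j /eqP; rewrite eqr_nat => /eqP.
Qed.

(** Every genericity argument below rests on this: a nonzero polynomial function can be multiplied
    by the equation of a bad locus without becoming zero. *)
Lemma pol_mul_neq0 F G a b :
  pol F -> pol G -> F a <> 0 -> G b <> 0 -> exists t, F t * G t <> 0.
Proof.
move=> pF pG Fa Gb; apply: NNPP => nex.
have [p hp] := pol_line a b pF; have [q hq] := pol_line a b pG.
have pq0 : p * q = 0.
  apply: poly_fun_eq0 => z; rewrite hornerM -hp -hq.
  by apply: NNPP => nz; apply: nex; eexists; exact: nz.
move/eqP: pq0; rewrite mulf_eq0 => /orP[] /eqP E.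
- apply: Fa; have := hp 0; rewrite E horner0 => <-.
  by congr F; apply: functional_extensionality => i; rewrite mul0r addr0.
- apply: Gb; have := hq 1; rewrite E horner0 => <-.
  by congr G; apply: functional_extensionality => i; rewrite mul1r addrCA subrr addr0.
Qed.

Lemma polyfun_opp f : polyfun f -> polyfun (fun mu => - f mu).
Proof.
move=> pf; have -> : (fun mu => - f mu) = (fun mu => -1 * f mu).
  by apply: functional_extensionality => t; rewrite mulN1r.
exact: pf_mul (pf_const _) pf.
Qed.

Lemma polyfun_sum (I : Type) (r : seq I) (f : I -> struct -> CC) :
  (forall i, polyfun (f i)) -> polyfun (fun mu => \sum_(i <- r) f i mu).
Proof.
move=> pf; elim: r => [|i r IHr].
  have -> : (fun mu => \sum_(i <- [::]) f i mu) = (fun=> 0).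
    by apply: functional_extensionality => t; rewrite big_nil.
  exact: pf_const.
have -> : (fun mu => \sum_(i <- i :: r) f i mu) =
          (fun mu => f i mu + \sum_(i <- r) f i mu).
  by apply: functional_extensionality => t; rewrite big_cons.
exact: pf_add.
Qed.

Lemma polyfun_comp f (T : struct -> struct) :
  polyfun f -> (forall i j k, polyfun (fun mu => T mu i j k)) -> polyfun (f \o T).
Proof.
move=> pf hT; elim: pf => /= [c|i j k|g h _ IHg _ IHh|g h _ IHg _ IHh].
- exact: pf_const.
- exact: hT.
- exact: pf_add IHg IHh.
- exact: pf_mul IHg IHh.
Qed.

Lemma polyfun_act g f : polyfun f -> polyfun (f \o act g).
Proof.
move=> pf; apply: polyfun_comp => // i j k.
apply: polyfun_sum => a; apply: polyfun_sum => b; apply: polyfun_sum => c.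
apply: pf_mul (pf_const _); apply: pf_mul; [exact: pf_const | exact: pf_coord].
Qed.

(** * Zariski closed and irreducible sets *)

Lemma zclosed_zero f : polyfun f -> zclosed (fun mu => f mu = 0).
Proof.
move=> pf; exists (fun g => g = f); split=> [g -> //|mu].
by split=> [E g -> //|]; apply.
Qed.

Lemma zclosedI A B : zclosed A -> zclosed B -> zclosed (fun mu => A mu /\ B mu).
Proof.
move=> [P [hP eP]] [Q [hQ eQ]]; exists (fun f => P f \/ Q f); split.
  by move=> f [/hP|/hQ].
move=> mu; split=> [[/eP a /eQ b] f [/a|/b] //|h].
by split; [apply/eP | apply/eQ] => f hf; apply: h; [left | right].
Qed.

Lemma zclosedU A B : zclosed A -> zclosed B -> zclosed (fun mu => A mu \/ B mu).
Proof.
move=> [P [hP eP]] [Q [hQ eQ]].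
exists (fun h => exists f g, [/\ P f, Q g & h = fun mu => f mu * g mu]); split.
  by move=> h [f [g [/hP pf /hQ pg ->]]]; apply: pf_mul.
move=> mu; split.
  move=> [/eP|/eQ] h k [f [g [Pf Qg ->]]]; first by rewrite (h f) // mul0r.
  by rewrite (h g) // mulr0.
move=> h; apply: NNPP => /not_or_and [nA nB].
apply: nA; apply/eP => f Pf; apply: NNPP => fz.
apply: nB; apply/eQ => g Qg; apply: NNPP => gz.
have /eqP := h _ (ex_intro _ f (ex_intro _ g (And3 Pf Qg erefl))).
by rewrite mulf_eq0 => /orP[] /eqP.
Qed.

Lemma zclosed_ext A B : seteq_ A B -> zclosed A -> zclosed B.
Proof.
move=> eAB [P [hP eP]]; exists P; split=> // mu.
by split=> [/eAB /eP|/eP /eAB].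
Qed.

Lemma zclosed_empty : zclosed (fun=> False).
Proof.
apply: zclosed_ext (zclosed_zero (pf_const 1)) => mu.
by split=> // /eqP; rewrite oner_eq0.
Qed.

Lemma zclosed_bigU (I : eqType) (r : seq I) (W : I -> pset) :
  (forall i, zclosed (W i)) -> zclosed (fun mu => exists2 i, i \in r & W i mu).
Proof.
move=> hW; elim: r => [|i r IHr].
  by apply: zclosed_ext zclosed_empty => mu; split=> // -[].
apply: zclosed_ext (zclosedU (hW i) IHr) => mu; split.
  case=> [Wi|[j jr Wj]]; first by exists i; rewrite ?mem_head.
  by exists j; rewrite // inE jr orbT.
case=> j; rewrite inE => /orP[/eqP->|jr] Wj; first by left.
by right; exists j.
Qed.

Definition zclosure (S : pset) : pset :=
  fun mu => forall f, polyfun f -> (forall nu, S nu -> f nu = 0) -> f mu = 0.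

Lemma zclosure_closed S : zclosed (zclosure S).
Proof.
exists (fun f => polyfun f /\ forall nu, S nu -> f nu = 0); split; first by move=> f [].
by move=> mu; split=> [h f []|h f pf fS]; [apply: h | apply: h].
Qed.

Lemma sub_zclosure S : subset_ S (zclosure S).
Proof. by move=> mu Smu f _; apply. Qed.

Lemma zclosure_min S W : zclosed W -> subset_ S W -> subset_ (zclosure S) W.
Proof.
move=> [P [hP eP]] SW mu hmu; apply/eP => f Pf.
by apply: hmu; [exact: hP | move=> nu /SW /eP; apply].
Qed.

(** For closed [X] the relative closure is the absolute one, which can be tested one polynomial at a
    time. *)
Lemma closure_inE X S : subset_ S X -> zclosed X ->
  seteq_ (closure_in X S) (zclosure S).
Proof.
move=> SX cX mu; split.
  move=> [Xmu h]; have [] // := h (fun nu => X nu /\ zclosure S nu).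
  - by exists (zclosure S); split=> //; exact: zclosure_closed.
  - by move=> nu Snu; split; [exact: SX | exact: sub_zclosure].
move=> hmu; split; first exact: zclosure_min hmu.
move=> Z [W [cW eW]] SZ; apply/eW; split; first exact: zclosure_min hmu.
by apply: zclosure_min hmu => // nu /SZ /eW [].
Qed.

Definition image_of (Phi : env -> struct) : pset := fun mu => exists t, mu = Phi t.

(** If neither closed set contains the image, each has an equation with nonzero pullback; the
    product of the pullbacks is nonzero at some parameter, whose image then lies in neither set. *)
Lemma zirreducible_image Phi : polmap Phi -> zirreducible (zclosure (image_of Phi)).
Proof.
move=> hPhi; split; first by exists (Phi (fun=> 0)); apply: sub_zclosure; eexists.
move=> Z1 Z2 [P1 [hP1 e1]] [P2 [hP2 e2]] sub; apply: NNPP => /not_or_and [n1 n2].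
have ex P Z : (forall f, P f -> polyfun f) -> seteq_ Z (fun mu => forall f, P f -> f mu = 0) ->
    ~ subset_ (zclosure (image_of Phi)) Z -> exists f t, P f /\ f (Phi t) <> 0.
  move=> hP eZ nsub; apply: NNPP => nex; apply: nsub => mu hmu.
  apply/eZ => f Pf; apply: hmu; first exact: hP.
  by move=> _ [t ->]; apply: NNPP => nz; apply: nex; exists f, t.
have [f [a [Pf fa]]] := ex _ _ hP1 e1 n1.
have [g [b [Pg gb]]] := ex _ _ hP2 e2 n2.
have [t] := pol_mul_neq0 (pol_comp (hP1 _ Pf) hPhi) (pol_comp (hP2 _ Pg) hPhi) fa gb.
apply; have im : image_of Phi (Phi t) by exists t.
by case: (sub _ (sub_zclosure im)) => [/e1/(_ f Pf)|/e2/(_ g Pg)] /= ->; rewrite ?mul0r ?mulr0.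
Qed.

Lemma zirreducible_ext A B : seteq_ A B -> zirreducible A -> zirreducible B.
Proof.
move=> eAB [[mu Amu] h]; split; first by exists mu; apply/eAB.
move=> Z1 Z2 c1 c2 sub.
have [|s|s] := h _ _ c1 c2; first by move=> nu /eAB /sub.
  by left=> nu /eAB /s.
by right=> nu /eAB /s.
Qed.

Lemma zirreducible_bigU (I : eqType) (r : seq I) (W : I -> pset) Y :
  (forall i, zclosed (W i)) -> zirreducible Y ->
  subset_ Y (fun mu => exists2 i, i \in r & W i mu) ->
  exists2 i, i \in r & subset_ Y (W i).
Proof.
move=> hW [[mu0 Y0] irr]; elim: r => [|i r IHr] sub; first by have [] := sub _ Y0.
have [|s|s] := irr _ _ (hW i) (zclosed_bigU r hW).
- move=> mu /sub [j]; rewrite inE => /orP[/eqP->|jr] Wj; first by left.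
  by right; exists j.
- by exists i; rewrite ?mem_head.
- by have [j jr Yj] := IHr s; exists j; rewrite // inE jr orbT.
Qed.

(** * Algebraic independence and the length of chains *)

(* [coefs k] is the type of (dense) polynomials in [k] variables, as iterated coefficient lists. *)
Fixpoint coefs (k : nat) : Type := if k is k'.+1 then seq (coefs k') else CC.

(** The lists are not normalized: zero entries may occur anywhere, so nonvanishing cannot be read
    off from the length. *)
Fixpoint cnz (k : nat) : coefs k -> Prop :=
  if k is k'.+1 return coefs k -> Prop
  then fix go s := if s is a :: s' then cnz a \/ go s' else False
  else fun c => c <> 0.

Fixpoint ceval (T : Type) (k : nat) : coefs k -> seq (T -> CC) -> T -> CC :=
  if k is k'.+1 return coefs k -> seq (T -> CC) -> T -> CC
  then fun s fs x =>
    foldr (fun a acc => ceval a (behead fs) x + head (fun=> 0) fs x * acc) 0 s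
  else fun c _ _ => c.

Lemma ceval_eq0 T k (d : coefs k) (fs : seq (T -> CC)) x : ~ cnz d -> ceval d fs x = 0.
Proof.
elim: k d fs => [|k IHk] /= d fs; first by move=> /NNPP.
elim: d => [//|a s IHs] /= /not_or_and [na ns].
by rewrite IHk // IHs // mulr0 addr0.
Qed.

Lemma ceval_cons T k (a : coefs k) (s : coefs k.+1) (fs : seq (T -> CC)) x :
  ceval (a :: s : coefs k.+1) fs x =
  ceval a (behead fs) x + head (fun=> 0) fs x * ceval s fs x.
Proof. by []. Qed.

Lemma ceval_map (S T : Type) k (d : coefs k) (fs : seq (T -> CC)) (g : S -> T) x :
  ceval d [seq f \o g | f <- fs] x = ceval d fs (g x).
Proof.
elim: k d fs => [//|k IHk] s fs.
elim: s => [//|a s IHs]; rewrite !ceval_cons IHs -IHk.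
by case: fs {IHs}.
Qed.

Lemma polyfun_ceval k (d : coefs k) fs :
  (forall i, (i < size fs)%N -> polyfun (nth (fun=> 0) fs i)) -> polyfun (ceval d fs).
Proof.
elim: k d fs => [|k IHk] /= d fs pfs; first exact: pf_const.
elim: d => [|a s IHs] /=; first exact: pf_const.
apply: pf_add.
  by apply: IHk => i; rewrite size_behead nth_behead => hi; apply: pfs; rewrite -ltn_predRL.
apply: pf_mul IHs.
case: fs pfs => [|f fs] pfs /=; first exact: pf_const.
exact: (pfs 0%N).
Qed.

Definition alg_indep (Z : pset) (fs : seq (struct -> CC)) :=
  (forall i, (i < size fs)%N -> polyfun (nth (fun=> 0) fs i)) /\
  forall d : coefs (size fs), cnz d -> exists2 mu, Z mu & ceval d fs mu <> 0.

(** Write a relation as a polynomial in [g]. If its constant coefficient is nonzero, it survives at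
    a point of [Z], where [g] vanishes. Otherwise the relation is divisible by [g], and
    irreducibility of [Z'] allows cancelling [g]; the coefficient list gets shorter. *)
Lemma alg_indep_step (Z Z' : pset) fs g :
  subset_ Z Z' -> zirreducible Z' -> alg_indep Z fs -> polyfun g ->
  (forall mu, Z mu -> g mu = 0) -> (exists2 mu, Z' mu & g mu <> 0) ->
  alg_indep Z' (g :: fs).
Proof.
move=> ZZ' [_ irr] [pfs ind] pg gZ [mu0 Z0 g0].
have pgfs i : (i < size (g :: fs))%N -> polyfun (nth (fun=> 0) (g :: fs) i).
  by case: i => [|i] //= /pfs.
split=> //= s; elim: s => [//|a s IHs] /=.
have [nza _|nza [//|nzs]] := classic (cnz a).
  have [mu Zmu h] := ind _ nza; exists mu; first exact: ZZ'.
  by rewrite (gZ _ Zmu) mul0r addr0.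
have [nu Z'nu h] := IHs nzs.
apply: NNPP => nex.
have pe : polyfun (ceval (s : coefs (size (g :: fs))) (g :: fs)) by exact: polyfun_ceval.
have [|/(_ _ Z0)//|/(_ _ Z'nu)//] := irr _ _ (zclosed_zero pg) (zclosed_zero pe).
move=> mu Z'mu; apply: NNPP => /not_or_and [gmu emu]; apply: nex; exists mu => //.
rewrite (ceval_eq0 _ _ nza) add0r => h0.
have /eqP : g mu * ceval (s : coefs (size (g :: fs))) (g :: fs) mu = 0 by exact: h0.
by rewrite mulf_eq0 => /orP[] /eqP.
Qed.

Lemma irr_chain_indep X n : irr_chain X n ->
  exists fs Z, [/\ subset_ Z X, zirreducible Z, size fs = n & alg_indep Z fs].
Proof.
move=> [Z [hZ hstrict]].
suff H k : (k <= n)%N -> exists fs, size fs = k /\ alg_indep (Z k) fs.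
  have [fs [sz ind]] := H n (leqnn _); have [[W [_ eW]] irr] := hZ n (leqnn _).
  by exists fs, (Z n); split=> // mu /eW [].
elim: k => [_|k IHk lekn].
  exists [::]; split=> //; split=> //= c c0.
  by have [_ [[mu Zmu] _]] := hZ 0%N isT; exists mu.
have [fs [sz ind]] := IHk (ltnW lekn).
have [sub [mu [Zmu nZmu]]] := hstrict k lekn.
have [_ irr] := hZ k.+1 lekn.
have [[W [[P [hP eP]] eW]] _] := hZ k (ltnW lekn).
(* Since [mu] lies in [X], it can be outside [Z k] only by violating an equation of the closed set
   [W]. *)
have [f [Pf fmu]] : exists f, P f /\ f mu <> 0.
  apply: NNPP => nex; apply: nZmu; apply/eW; split.
    by have [[W' [_ eW']] _] := hZ k.+1 lekn; have [] := (eW' mu).1 Zmu.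
  by apply/eP => f Pf; apply: NNPP => nz; apply: nex; exists f.
exists (f :: fs); split; first by rewrite /= sz.
apply: alg_indep_step ind _ _ _ => //.
- exact: hP.
- by move=> nu /eW [_ /eP]; apply.
- by exists mu.
Qed.

(** * Six polynomials in five variables are algebraically dependent *)

Section Counting.

Variable n : nat.
Implicit Types (x : 'I_n -> CC) (F G : ('I_n -> CC) -> CC).

Definition monomial (e : 'I_n -> nat) x : CC := \prod_i x i ^+ e i.

(** The degree is bounded in each variable separately: there are then exactly (K+1)^n monomials, and
    the bounds add under multiplication. *)
Inductive bounded_poly (K : nat) : (('I_n -> CC) -> CC) -> Prop :=
| bp_zero : bounded_poly K (fun=> 0)
| bp_mono e : (forall i, e i <= K)%N -> bounded_poly K (monomial e)
| bp_scale c F : bounded_poly K F -> bounded_poly K (fun x => c * F x)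
| bp_add F G : bounded_poly K F -> bounded_poly K G -> bounded_poly K (fun x => F x + G x).

Lemma bp_ext K F G : F =1 G -> bounded_poly K F -> bounded_poly K G.
Proof. by move=> /functional_extensionality ->. Qed.

Lemma bp_const K c : bounded_poly K (fun=> c).
Proof.
apply: bp_ext (bp_scale c (bp_mono (e := fun=> 0%N) _)) => // x.
by rewrite /monomial big1 ?mulr1.
Qed.

Lemma bp_var K i : (0 < K)%N -> bounded_poly K (fun x => x i).
Proof.
move=> K0; apply: bp_ext (bp_mono (e := fun j => (j == i) : nat) _) => [x|j].
  rewrite /monomial (bigD1 i) // eqxx expr1 big1 => [|j /andP[_ /negPf ->]]; first exact: mulr1.
  exact: expr0.
by case: (j == i).
Qed.

Lemma bp_leq K L F : (K <= L)%N -> bounded_poly K F -> bounded_poly L F.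
Proof.
move=> leKL; elim=> [|e he|c G _ IH|G H _ IHG _ IHH].
- exact: bp_zero.
- by apply: bp_mono => i; apply: leq_trans leKL.
- exact: bp_scale.
- exact: bp_add.
Qed.

Lemma bp_mul K L F G :
  bounded_poly K F -> bounded_poly L G -> bounded_poly (K + L) (fun x => F x * G x).
Proof.
move=> bF bG; elim: bF => [|e he|c F1 _ IH|F1 F2 _ IH1 _ IH2].
- by apply: bp_ext (bp_zero _) => x; rewrite mul0r.
- elim: bG => [|e' he'|c G1 _ IH|G1 G2 _ IH1 _ IH2].
  + by apply: bp_ext (bp_zero _) => x; rewrite mulr0.
  + apply: bp_ext (bp_mono (e := fun i => (e i + e' i)%N) _) => [x|i].
      by rewrite /monomial -big_split /=; apply: eq_bigr => i _; rewrite exprD.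
    exact: leq_add.
  + by apply: bp_ext (bp_scale c IH) => x; rewrite mulrCA.
  + by apply: bp_ext (bp_add IH1 IH2) => x; rewrite mulrDr.
- by apply: bp_ext (bp_scale c IH) => x; rewrite mulrA.
- by apply: bp_ext (bp_add IH1 IH2) => x; rewrite mulrDl.
Qed.

Lemma bp_exp K F m : bounded_poly K F -> bounded_poly (m * K) (fun x => F x ^+ m).
Proof.
move=> bF; elim: m => [|m IHm]; first exact: bp_const.
rewrite mulSn; apply: bp_ext (bp_mul bF IHm) => x.
by rewrite exprS.
Qed.

Lemma bp_coords K F : bounded_poly K F ->
  exists c : {ffun 'I_n -> 'I_K.+1} -> CC,
    forall x, F x = \sum_e c e * monomial (fun i => e i : nat) x.
Proof.
elim=> [|e he|a G _ [c hc]|G H _ [c hc] _ [d hd]].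
- by exists (fun=> 0) => x; rewrite big1 // => e _; rewrite mul0r.
- pose e1 : {ffun 'I_n -> 'I_K.+1} := [ffun i => inord (e i)].
  exists (fun e' => (e' == e1)%:R) => x.
  rewrite (bigD1 e1) // eqxx big1 => [|e' /andP[_ /negPf ->]]; last exact: mul0r.
  rewrite /= addr0 mul1r; apply: eq_bigr => i _; rewrite ffunE inordK //.
  exact: he.
- exists (fun e => a * c e) => x; rewrite hc mulr_sumr.
  by apply: eq_bigr => e _; rewrite mulrA.
- exists (fun e => c e + d e) => x; rewrite hc hd -big_split.
  by apply: eq_bigr => e _; rewrite mulrDl.
Qed.

(** The coefficient matrix has more rows than columns, hence a nonzero left kernel. *)
Lemma bp_dependent (I : finType) K (u : I -> ('I_n -> CC) -> CC) :
  (forall i, bounded_poly K (u i)) -> (K.+1 ^ n < #|I|)%N ->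
  exists2 c : I -> CC, (exists i, c i <> 0) & forall x, \sum_i c i * u i x = 0.
Proof.
move=> bu card_lt.
pose J := {ffun 'I_n -> 'I_K.+1}.
have /fin_all_exists [A hA] : forall i : I, exists c : {ffun J -> CC},
    forall x, u i x = \sum_e c e * monomial (fun i => e i : nat) x.
  move=> i; have [c hc] := bp_coords (bu i); exists [ffun e => c e] => x.
  by rewrite hc; apply: eq_bigr => e _; rewrite ffunE.
pose B : 'M[CC]_(#|I|, #|J|) := \matrix_(i, j) A (enum_val i) (enum_val j).
have : kermx B != 0.
  rewrite kermx_eq0 /row_free neq_ltn; apply/orP; left.
  by apply: leq_ltn_trans (rank_leq_col _) _; rewrite card_ffun !card_ord.
case/rowV0Pn => v /sub_kermxP vB v0.
exists (fun i => v 0 (enum_rank i)).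
  apply: NNPP => nex; case/eqP: v0; apply/rowP => j; rewrite mxE.
  by apply: NNPP => vj; apply: nex; exists (enum_val j); rewrite enum_valK.
move=> x.
under eq_bigr => i _ do rewrite hA mulr_sumr.
rewrite exchange_big big1 // => e _.
have /matrixP /(_ 0 (enum_rank e)) := vB; rewrite !mxE => h.
transitivity ((\sum_j v 0 j * B j (enum_rank e)) * monomial (fun i => e i : nat) x).
  2: by rewrite h mul0r.
rewrite mulr_suml.
rewrite (reindex_onto (@enum_val I I) enum_rank) => [|i _]; last by rewrite enum_rankK.
apply: eq_big => [i|i _]; first by rewrite enum_valK eqxx.
by rewrite mxE enum_rankK enum_valK mulrA.
Qed.

End Counting.

Fixpoint box (M k : nat) : finType :=
  if k is k'.+1 then ('I_M * box M k')%type : finType else unit.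

Lemma card_box M k : #|box M k| = (M ^ k)%N.
Proof.
by elim: k => [|k IHk] /=; rewrite ?card_unit // card_prod card_ord IHk expnS.
Qed.

Fixpoint bmon T M k : box M k -> seq (T -> CC) -> T -> CC :=
  if k is k'.+1 return box M k -> seq (T -> CC) -> T -> CC
  then fun e fs x => head (fun=> 0) fs x ^+ e.1 * bmon e.2 (behead fs) x
  else fun _ _ _ => 1.

Fixpoint box_coefs M k : (box M k -> CC) -> coefs k :=
  if k is k'.+1 return (box M k -> CC) -> coefs k
  then fun c => [seq box_coefs (fun e => c (j, e)) | j <- enum 'I_M]
  else fun c => c tt.

Lemma ceval_box T M k (c : box M k -> CC) (fs : seq (T -> CC)) x :
  ceval (box_coefs c) fs x = \sum_e c e * bmon e fs x.
Proof.
elim: k c fs => [|k IHk] c fs.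
  by rewrite (bigD1 tt) // big1 => [|[]//]; rewrite /= addr0 mulr1.
transitivity (\sum_(i < M) \sum_(e : box M k)
    c (i, e) * (head (fun=> 0) fs x ^+ i * bmon e (behead fs) x)).
  2: by rewrite pair_bigA; apply: eq_bigr => -[i e].
transitivity (\sum_(i < M) head (fun=> 0) fs x ^+ i * ceval (box_coefs (fun e => c (i, e))) (behead fs) x); last first.
  apply: eq_bigr => i _; rewrite IHk mulr_sumr; apply: eq_bigr => e _.
  exact: mulrCA.
set y : CC := head (fun=> 0) fs x.
(* Horner's scheme shifts exponents, so the induction runs over segments of the enumeration starting
   at an arbitrary index [m]. *)
have H (r : seq 'I_M) m : [seq val i | i <- r] = iota m (size r) ->
    y ^+ m * ceval ([seq box_coefs (fun e => c (j, e)) | j <- r] : coefs k.+1) fs x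
    = \sum_(i <- r) y ^+ i * ceval (box_coefs (fun e => c (i, e))) (behead fs) x.
  elim: r m => [|i r IHr] m; first by rewrite big_nil mulr0.
  case=> im hr; rewrite big_cons map_cons ceval_cons mulrDr mulrA -exprSr (IHr _ hr).
  by rewrite /= im.
rewrite -big_enum -(H _ 0%N) ?expr0 ?mul1r //.
by rewrite val_enum_ord size_enum_ord.
Qed.

Lemma cnz_box M k (c : box M k -> CC) : (exists e, c e <> 0) -> cnz (box_coefs c).
Proof.
elim: k c => [|k IHk] c /= [e he]; first by case: e he.
have : e.1 \in enum 'I_M by rewrite mem_enum.
elim: (enum 'I_M) => [//|j r IHr] /=; rewrite inE => /orP[/eqP ej|er].
  by left; apply: IHk; exists e.2; rewrite -ej -surjective_pairing.
by right; exact: IHr.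
Qed.

Lemma bp_bmon n K M k (e : box M k) (fs : seq (('I_n -> CC) -> CC)) :
  (forall i, bounded_poly K (nth (fun=> 0) fs i)) -> bounded_poly (k * (M * K)) (bmon e fs).
Proof.
elim: k e fs => [|k IHk] e fs bfs /=; first exact: bp_const.
rewrite mulSn; apply: bp_mul.
  apply: bp_leq (bp_exp e.1 (K := K) _).
    by rewrite leq_mul2r (ltnW (ltn_ord _)) orbT.
  by rewrite -nth0; exact: bfs.
by apply: IHk => i; rewrite nth_behead.
Qed.

Lemma bounded_dependent n (fs : seq (('I_n -> CC) -> CC)) :
  size fs = n.+1 -> (forall i, exists K, bounded_poly K (nth (fun=> 0) fs i)) ->
  exists2 d : coefs n.+1, cnz d & forall x, ceval d fs x = 0.
Proof.
move=> sz bfs.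
have [K bK] : exists K, forall i, bounded_poly K (nth (fun=> 0) fs i).
  elim: fs {sz} bfs => [|f fs IH] bfs.
    by exists 0%N => i; rewrite nth_nil; exact: bp_zero.
  have [K hK] := bfs 0%N; have [|L hL] := IH; first by move=> i; exact: (bfs i.+1).
  exists (maxn K L) => -[|i] /=; first by apply: bp_leq hK; exact: leq_maxl.
  by apply: bp_leq (hL i); exact: leq_maxr.
(* The M^(n+1) monomials with exponents below M in the n+1 functions have degree at most (n+1)MK in
   each variable, so they lie in a span of dimension at most (MA)^n. The choice M = A^n + 1 makes
   M^(n+1) larger. *)
pose A := (n.+1 * K).+1; pose M := (A ^ n).+1.
have [||c c0 hc] := @bp_dependent n (box M n.+1) (n.+1 * (M * K)) (fun e => bmon e fs).
- by move=> e; exact: bp_bmon.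
- rewrite card_box.
  have le1 : ((n.+1 * (M * K)).+1 <= M * A)%N by rewrite /A mulnS mulnCA; lia.
  have le2 : ((n.+1 * (M * K)).+1 ^ n <= (M * A) ^ n)%N by case: (n) le1 => // m; rewrite leq_exp2r.
  apply: leq_ltn_trans le2 _; rewrite expnMn expnSr ltn_mul2l expn_gt0 /=.
  exact: ltnSn.
exists (box_coefs c); first exact: cnz_box.
by move=> x; rewrite ceval_box.
Qed.

(** * Orbits *)

(** One coordinate of the product as a bilinear form, so that a change of basis becomes a
    congruence. *)
Definition slice (mu : struct) (k : 'I_3) : 'M[CC]_3 := \matrix_(i, j) mu i j k.

Lemma structP (mu nu : struct) : (forall i j k, mu i j k = nu i j k) -> mu = nu.
Proof.
move=> h; do 3 (apply: functional_extensionality => ?); exact: h.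
Qed.

Lemma slice_inj mu nu : (forall k, slice mu k = slice nu k) -> mu = nu.
Proof.
move=> h; apply: structP => i j k.
by have /matrixP /(_ i j) := h k; rewrite !mxE.
Qed.

Lemma slice_act g mu k :
  slice (act g mu) k = \sum_c g k c *: ((invmx g)^T *m slice mu c *m invmx g).
Proof.
apply/matrixP => i j; rewrite mxE summxE /act.
rewrite exchange_big /=; under eq_bigr => b _ do rewrite exchange_big.
rewrite exchange_big; apply: eq_bigr => c _.
rewrite !mxE mulr_sumr; apply: eq_bigr => b _.
rewrite !mxE !mulr_suml mulr_sumr; apply: eq_bigr => a _.
by rewrite !mxE; ring.
Qed.

(** Multiplicativity of the linear map [h] from [nu] to [mu], one target coordinate at a time.
    Unlike [act] it involves no inverse, so it reduces to polynomial identities. *)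
Definition homstr (h : 'M[CC]_3) (nu mu : struct) :=
  forall c, \sum_k h c k *: slice nu k = h^T *m slice mu c *m h.

Lemma sum_delta_slice (M : 'I_3 -> 'M[CC]_3) c : \sum_d (1%:M : 'M[CC]_3) c d *: M d = M c.
Proof.
rewrite (bigD1 c) // mxE eqxx scale1r big1 /= ?addr0 // => d /negPf dc.
by rewrite mxE eq_sym dc scale0r.
Qed.

Lemma sum_mulmx_slice (g h : 'M[CC]_3) (M : 'I_3 -> 'M[CC]_3) c :
  \sum_k (g *m h) c k *: M k = \sum_d g c d *: \sum_k h d k *: M k.
Proof.
under [RHS]eq_bigr => d _ do rewrite scaler_sumr.
rewrite [RHS]exchange_big; apply: eq_bigr => k _.
by rewrite mxE scaler_suml; apply: eq_bigr => d _; rewrite scalerA.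
Qed.

Lemma homstr_inj h nu nu' mu :
  h \in unitmx -> homstr h nu mu -> homstr h nu' mu -> nu = nu'.
Proof.
move=> hu H H'; apply: slice_inj => k.
rewrite -[LHS](sum_delta_slice (slice nu)) -[RHS](sum_delta_slice (slice nu')).
rewrite -(mulVmx hu) !sum_mulmx_slice; apply: eq_bigr => d _.
by rewrite H H'.
Qed.

Lemma homstr_comp h g nu mu rho :
  homstr h nu mu -> homstr g mu rho -> homstr (g *m h) nu rho.
Proof.
move=> H G c; rewrite sum_mulmx_slice.
under eq_bigr => d _ do rewrite H scalemxAl scalemxAr.
by rewrite -mulmx_suml -mulmx_sumr G trmx_mul !mulmxA.
Qed.

Lemma homstr_inv h nu mu : h \in unitmx -> homstr h nu mu -> homstr (invmx h) mu nu.
Proof.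
move=> hu H c.
transitivity (\sum_d invmx h c d *: ((invmx h)^T *m (h^T *m slice mu d *m h) *m invmx h)).
  apply: eq_bigr => d _; rewrite -!mulmxA mulmxV // mulmx1.
  by rewrite mulmxA -trmx_mul mulmxV // trmx1 mul1mx.
under eq_bigr => d _ do rewrite scalemxAl scalemxAr -H.
rewrite -mulmx_suml -mulmx_sumr -sum_mulmx_slice mulVmx //.
by rewrite sum_delta_slice.
Qed.

(** Projection onto the odd part. Being even means commuting with it, a property that passes at once
    to products and inverses. *)
Definition parity_mx : 'M[CC]_3 := \matrix_(i, j) ((i == j) && deg i)%:R.

Lemma grGL_comm (h : 'M[CC]_3) :
  (forall i j : 'I_3, deg i != deg j -> h i j = 0) <-> parity_mx *m h = h *m parity_mx.
Proof.
have E1 i j : (parity_mx *m h) i j = (deg i)%:R * h i j.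
  rewrite mxE (bigD1 i) // big1 /= => [|k /negPf ki]; rewrite mxE ?eqxx ?addr0 //.
  by rewrite eq_sym ki mul0r.
have E2 i j : (h *m parity_mx) i j = h i j * (deg j)%:R.
  rewrite mxE (bigD1 j) // big1 /= => [|k /negPf ki]; rewrite mxE ?eqxx ?addr0 //.
  by rewrite ki mulr0.
split=> [H|/matrixP H i j].
  apply/matrixP => i j; rewrite E1 E2.
  have [->|/H ->] := eqVneq (deg i) (deg j); first by rewrite mulrC.
  by rewrite mulr0 mul0r.
have := H i j; rewrite E1 E2.
by case: (deg i); case: (deg j); rewrite // ?mul1r ?mulr1 ?mul0r ?mulr0 => ->.
Qed.

Lemma grGL1 : grGL 1%:M.
Proof. by split; [exact: unitmx1 | apply/grGL_comm; rewrite mulmx1 mul1mx]. Qed.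

Lemma grGL_mul g h : grGL g -> grGL h -> grGL (g *m h).
Proof.
move=> [gu /grGL_comm gc] [hu /grGL_comm hc]; split; first by rewrite unitmx_mul gu.
by apply/grGL_comm; rewrite mulmxA gc -mulmxA hc mulmxA.
Qed.

Lemma grGL_inv g : grGL g -> grGL (invmx g).
Proof.
move=> [gu /grGL_comm gc]; split; first by rewrite unitmx_inv.
apply/grGL_comm; apply: (can_inj (mulKmx gu)).
by rewrite mulmxA -gc mulmxK // mulKVmx.
Qed.

Lemma sorbitP mu nu : sorbit mu nu <-> exists2 h, grGL h & homstr h nu mu.
Proof.
split=> [[g [gG E]]|[h hG H]].
  have gu := gG.1; exists (invmx g); first exact: grGL_inv.
  move=> c; have -> : nu = act g mu by apply: structP.
  under eq_bigr => k _ do rewrite slice_act.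
  by rewrite -sum_mulmx_slice mulVmx // sum_delta_slice.
exists (invmx h); split; first exact: grGL_inv.
move=> i j k; suff -> : nu = act (invmx h) mu by [].
apply: slice_inj => {}k; rewrite slice_act invmxK.
under eq_bigr => c _ do rewrite -H.
by rewrite -sum_mulmx_slice mulVmx ?sum_delta_slice //; exact: hG.1.
Qed.

Lemma sorbit_refl mu : sorbit mu mu.
Proof.
apply/sorbitP; exists 1%:M; first exact: grGL1.
by move=> c; rewrite sum_delta_slice trmx1 mul1mx mulmx1.
Qed.

Lemma sorbit_sym mu nu : sorbit mu nu -> sorbit nu mu.
Proof.
move=> /sorbitP [h hG H]; apply/sorbitP; exists (invmx h); first exact: grGL_inv.
by apply: homstr_inv H; exact: hG.1.
Qed.

Lemma sorbit_trans mu nu rho : sorbit mu nu -> sorbit nu rho -> sorbit mu rho.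
Proof.
move=> /sorbitP [h hG H] /sorbitP [g gG G]; apply/sorbitP.
by exists (h *m g); [exact: grGL_mul | exact: homstr_comp G H].
Qed.

Lemma zclosure_sorbit mu nu rho :
  zclosure (sorbit mu) nu -> sorbit nu rho -> zclosure (sorbit mu) rho.
Proof.
move=> hnu [g [gG E]] f pf f0.
have -> : rho = act g nu by apply: structP.
apply: (hnu _ (polyfun_act g pf)) => tau otau; apply: f0.
by apply: sorbit_trans otau _; exists g.
Qed.

(** * Coordinates *)

Local Notation o0 := (@Ordinal 3 0 isT).
Local Notation o1 := (@Ordinal 3 1 isT).
Local Notation o2 := (@Ordinal 3 2 isT).

Lemma ord3P (P : 'I_3 -> Prop) : P o0 -> P o1 -> P o2 -> forall i, P i.
Proof.
move=> h0 h1 h2 [[|[|[|//]]] hi].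
- by rewrite (_ : Ordinal hi = o0) //; apply: val_inj.
- by rewrite (_ : Ordinal hi = o1) //; apply: val_inj.
- by rewrite (_ : Ordinal hi = o2) //; apply: val_inj.
Qed.

Lemma sum3 (V : nmodType) (f : 'I_3 -> V) : \sum_k f k = f o0 + f o1 + f o2.
Proof.
rewrite !big_ord_recl big_ord0 addr0 addrA.
by congr (f _ + f _ + f _); apply: val_inj.
Qed.

(* The even structures: e_1 e_1 = (a1,a2), e_1 e_2 = (b1,b2), e_2 e_1 = (c1,c2), e_2 e_2 = (d1,d2),
   e_i f = l_i f, f e_i = r_i f, f f = (s1,s2). *)
Definition mkeven (a1 a2 b1 b2 c1 c2 d1 d2 l1 l2 r1 r2 s1 s2 : CC) : struct :=
  fun i j k => match nat_of_ord i, nat_of_ord j, nat_of_ord k with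
  | 0, 0, 0 => a1 | 0, 0, 1 => a2
  | 0, 1, 0 => b1 | 0, 1, 1 => b2
  | 1, 0, 0 => c1 | 1, 0, 1 => c2
  | 1, 1, 0 => d1 | 1, 1, 1 => d2
  | 0, 2, 2 => l1 | 1, 2, 2 => l2
  | 2, 0, 2 => r1 | 2, 1, 2 => r2
  | 2, 2, 0 => s1 | 2, 2, 1 => s2
  | _, _, _ => 0%R
  end%N.

Lemma even_mkeven mu : even_str mu ->
  mu = mkeven (mu o0 o0 o0) (mu o0 o0 o1) (mu o0 o1 o0) (mu o0 o1 o1)
    (mu o1 o0 o0) (mu o1 o0 o1) (mu o1 o1 o0) (mu o1 o1 o1)
    (mu o0 o2 o2) (mu o1 o2 o2) (mu o2 o0 o2) (mu o2 o1 o2) (mu o2 o2 o0) (mu o2 o2 o1).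
Proof.
move=> ev; apply: structP; do 3 apply: ord3P => //; exact: ev.
Qed.

Definition blk (p1 p2 q1 q2 z : CC) : 'M[CC]_3 :=
  \matrix_(i, j) match nat_of_ord i, nat_of_ord j with
  | 0, 0 => p1 | 0, 1 => p2 | 1, 0 => q1 | 1, 1 => q2 | 2, 2 => z | _, _ => 0%R
  end%N.

Lemma blk_mul_eq1 p1 p2 q1 q2 z P1 P2 Q1 Q2 Z :
  blk p1 p2 q1 q2 z *m blk P1 P2 Q1 Q2 Z = 1%:M ->
  p1 * q2 - p2 * q1 != 0 /\ z != 0.
Proof.
move=> /matrixP E.
have e00 : p1 * P1 + p2 * Q1 = 1.
  by have := E o0 o0; rewrite !mxE !sum3 !mxE /= mulr0 addr0.
have e01 : p1 * P2 + p2 * Q2 = 0.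
  by have := E o0 o1; rewrite !mxE !sum3 !mxE /= mulr0 addr0.
have e10 : q1 * P1 + q2 * Q1 = 0.
  by have := E o1 o0; rewrite !mxE !sum3 !mxE /= mulr0 addr0.
have e11 : q1 * P2 + q2 * Q2 = 1.
  by have := E o1 o1; rewrite !mxE !sum3 !mxE /= mulr0 addr0.
have e22 : z * Z = 1.
  by have := E o2 o2; rewrite !mxE !sum3 !mxE /= !mulr0 !add0r.
split; apply/eqP => D0; have /eqP := oner_neq0 CC; apply; last by rewrite -e22 D0 mul0r.
transitivity ((p1 * P1 + p2 * Q1) * (q1 * P2 + q2 * Q2)
  - (p1 * P2 + p2 * Q2) * (q1 * P1 + q2 * Q1)); first by rewrite e00 e01 e11; ring.
transitivity ((p1 * q2 - p2 * q1) * (P1 * Q2 - P2 * Q1)); first by ring.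
by rewrite D0 mul0r.
Qed.

Lemma grGL_blk h : grGL h ->
  exists p1 p2 q1 q2 z, [/\ h = blk p1 p2 q1 q2 z, p1 * q2 - p2 * q1 != 0 & z != 0].
Proof.
have B g : grGL g -> g = blk (g o0 o0) (g o0 o1) (g o1 o0) (g o1 o1) (g o2 o2).
  move=> [_ g0]; apply/matrixP; do 2 apply: ord3P; rewrite mxE //; exact: g0.
move=> hG; have [hu _] := hG; have := mulmxV hu.
rewrite {1}(B _ hG) (B _ (grGL_inv hG)) => /blk_mul_eq1 [D0 z0].
by do 5 eexists; split; [exact: B | |].
Qed.

Lemma blk_grGL p1 p2 q1 q2 z :
  p1 * q2 - p2 * q1 != 0 -> z != 0 -> grGL (blk p1 p2 q1 q2 z).
Proof.
set D := _ - _ => D0 z0.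
split; last by do 2 apply: ord3P; rewrite // mxE.
have /mulmx1_unit [] // : blk p1 p2 q1 q2 z *m
    blk (q2 / D) (- p2 / D) (- q1 / D) (p1 / D) z^-1 = 1%:M.
apply/matrixP; do 2 apply: ord3P; rewrite !mxE !sum3 !mxE /= /D; field => //.
Qed.

(** The columns [(p1, q1)] and [(p2, q2)] are the images of e_1 and e_2, and f is scaled by [z]. The
    conditions on the characters carry no [z], since it would occur on both sides. *)
Lemma hom_mkeven p1 p2 q1 q2 z
    a1 a2 b1 b2 c1 c2 d1 d2 l1 l2 r1 r2 s1 s2 A1 A2 B1 B2 C1 C2 D1 D2 L1 L2 R1 R2 S1 S2 :
  let P w1 w2 := p1 * w1 + p2 * w2 in
  let Q w1 w2 := q1 * w1 + q2 * w2 in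
  let M x1 x2 y1 y2 u v w t := x1 * y1 * u + x1 * y2 * v + x2 * y1 * w + x2 * y2 * t in
  [/\ P a1 a2 = M p1 q1 p1 q1 A1 B1 C1 D1, Q a1 a2 = M p1 q1 p1 q1 A2 B2 C2 D2,
      P b1 b2 = M p1 q1 p2 q2 A1 B1 C1 D1 & Q b1 b2 = M p1 q1 p2 q2 A2 B2 C2 D2] ->
  [/\ P c1 c2 = M p2 q2 p1 q1 A1 B1 C1 D1, Q c1 c2 = M p2 q2 p1 q1 A2 B2 C2 D2,
      P d1 d2 = M p2 q2 p2 q2 A1 B1 C1 D1 & Q d1 d2 = M p2 q2 p2 q2 A2 B2 C2 D2] ->
  [/\ l1 = p1 * L1 + q1 * L2, l2 = p2 * L1 + q2 * L2,
      r1 = p1 * R1 + q1 * R2 & r2 = p2 * R1 + q2 * R2] ->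
  P s1 s2 = z * z * S1 /\ Q s1 s2 = z * z * S2 ->
  homstr (blk p1 p2 q1 q2 z) (mkeven a1 a2 b1 b2 c1 c2 d1 d2 l1 l2 r1 r2 s1 s2)
    (mkeven A1 A2 B1 B2 C1 C2 D1 D2 L1 L2 R1 R2 S1 S2).
Proof.
move=> P Q M [e1 e2 e3 e4] [f1 f2 f3 f4] [g1 g2 g3 g4] [h1 h2].
move: e1 e2 e3 e4 f1 f2 f3 f4 g1 g2 g3 g4 h1 h2; rewrite /P /Q /M => {P Q M}.
move=> e1 e2 e3 e4 f1 f2 f3 f4 -> -> -> -> h1 h2.
apply: ord3P; apply/matrixP; do 2 apply: ord3P;
  rewrite summxE !mxE !sum3 !mxE !sum3 !mxE /mkeven /=; try ring.
all: first
  [ etransitivity; [|etransitivity; [exact: e1|]]; ring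
  | etransitivity; [|etransitivity; [exact: e2|]]; ring
  | etransitivity; [|etransitivity; [exact: e3|]]; ring
  | etransitivity; [|etransitivity; [exact: e4|]]; ring
  | etransitivity; [|etransitivity; [exact: f1|]]; ring
  | etransitivity; [|etransitivity; [exact: f2|]]; ring
  | etransitivity; [|etransitivity; [exact: f3|]]; ring
  | etransitivity; [|etransitivity; [exact: f4|]]; ring
  | etransitivity; [|etransitivity; [exact: h1|]]; ring
  | etransitivity; [|etransitivity; [exact: h2|]]; ring ].
Qed.

(** * The thirteen families *)

(** Associativity of a commutative product says that the matrix with rows (a2, b1, a1 - b2) and (b2,
    d1, b1 - d2) has rank at most 1; here the rows are [al] and [be] times (x, y, z). *)
Definition comm_mult (al be x y z l1 l2 r1 r2 s1 s2 : CC) : struct :=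
  mkeven (al * z + be * x) (al * x) (al * y) (be * x)
         (al * y) (be * x) (be * y) (al * y - be * z) l1 l2 r1 r2 s1 s2.

(* The commutative part of the variety of 2-dimensional associative algebras is the cone over
   P^1 x P^2 times a plane: [(al, be)] and [(x, y, z)] are the two factors. Splitting the binary form
   x be^2 + z al be - y al^2 into the linear forms (be m - al n) (be m' - al n'), the characters are
   L = (be m' - al n') (m, n) and L' = (be m - al n) (m', n'); the annihilator of (m', n') is an
   eigenline, on which the even part acts by L.
   The parameters are al, be, n, n', c, m, m' in this order. *)
Definition comm_family (u1 u2 v1 v2 k : CC) (t : env) : struct :=
  let al := t 0%N in let be := t 1%N in let n := t 2%N in let n' := t 3%N in
  let c := t 4%N in let m := t 5%N in let m' := t 6%N in
  let K := be * m' - al * n' in let K' := be * m - al * n in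
  comm_mult al be (m * m') (- (n * n')) (- (m * n' + n * m'))
    (u1 * (K * m) + u2 * (K' * m')) (u1 * (K * n) + u2 * (K' * n'))
    (v1 * (K * m) + v2 * (K' * m')) (v1 * (K * n) + v2 * (K' * n'))
    (k * (c * n')) (- (k * (c * m'))).

Definition left_family (u v : CC) (t : env) : struct :=
  let p := t 0%N in let q := t 1%N in
  mkeven p 0 0 p q 0 0 q (u * p) (u * q) (v * p) (v * q) 0 0.

Definition right_family (u v : CC) (t : env) : struct :=
  let p := t 0%N in let q := t 1%N in
  mkeven p 0 q 0 0 p 0 q (u * p) (u * q) (v * p) (v * q) 0 0.

(** The order is that of [Rtable]. In [comm_family], [u1 u2] and [v1 v2] are the coefficients of l
    and r on L and L', and [k] switches the odd square on. *)
Definition stdfamily (i : nat) : env -> struct :=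
  nth (fun=> mkeven 0 0 0 0 0 0 0 0 0 0 0 0 0 0)
   [:: comm_family 0 0 0 0 0; comm_family 1 0 1 0 1; comm_family 0 0 1 0 0;
       comm_family 1 0 0 0 0; comm_family 0 1 1 0 0;
       left_family 0 0; right_family 0 0; right_family 1 0; left_family 0 1;
       right_family 0 1; left_family 1 0; right_family 1 1; left_family 1 1] i.

Definition mkenv (s : seq CC) : env := fun i => s`_i.

Lemma even_of_mkeven a1 a2 b1 b2 c1 c2 d1 d2 l1 l2 r1 r2 s1 s2 :
  even_str (mkeven a1 a2 b1 b2 c1 c2 d1 d2 l1 l2 r1 r2 s1 s2).
Proof. by do 3 apply: ord3P. Qed.

Lemma ord13P (P : nat -> Prop) :
  P 0%N -> P 1%N -> P 2%N -> P 3%N -> P 4%N -> P 5%N -> P 6%N -> P 7%N -> P 8%N ->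
  P 9%N -> P 10%N -> P 11%N -> P 12%N -> forall i : 'I_13, P i.
Proof. by move=> ? ? ? ? ? ? ? ? ? ? ? ? ? [i]; do 13 case: i => [//|i]. Qed.

Definition simp0 := (@mul0r CC, @mulr0 CC, @add0r CC, @addr0 CC).

Definition even_assoc (a1 a2 b1 b2 c1 c2 d1 d2 : CC) : Prop :=
  [/\ [/\ a1 * a1 + a2 * c1 = a1 * a1 + a2 * b1, a1 * a2 + a2 * c2 = a1 * a2 + a2 * b2,
      a1 * b1 + a2 * d1 = b1 * a1 + b2 * b1 & a1 * b2 + a2 * d2 = b1 * a2 + b2 * b2],
      [/\ b1 * a1 + b2 * c1 = c1 * a1 + c2 * b1, b1 * a2 + b2 * c2 = c1 * a2 + c2 * b2,
          b1 * b1 + b2 * d1 = d1 * a1 + d2 * b1 & b1 * b2 + b2 * d2 = d1 * a2 + d2 * b2],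
      [/\ c1 * a1 + c2 * c1 = a1 * c1 + a2 * d1, c1 * a2 + c2 * c2 = a1 * c2 + a2 * d2,
          c1 * b1 + c2 * d1 = b1 * c1 + b2 * d1 & c1 * b2 + c2 * d2 = b1 * c2 + b2 * d2]
    & [/\ d1 * a1 + d2 * c1 = c1 * c1 + c2 * d1, d1 * a2 + d2 * c2 = c1 * c2 + c2 * d2,
        d1 * b1 + d2 * d1 = d1 * c1 + d2 * d1 & d1 * b2 + d2 * d2 = d1 * c2 + d2 * d2]].

Definition left_module (a1 a2 b1 b2 c1 c2 d1 d2 l1 l2 : CC) : Prop :=
  [/\ a1 * l1 + a2 * l2 = l1 * l1, b1 * l1 + b2 * l2 = l2 * l1,
      c1 * l1 + c2 * l2 = l1 * l2 & d1 * l1 + d2 * l2 = l2 * l2].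

Definition right_module (a1 a2 b1 b2 c1 c2 d1 d2 r1 r2 : CC) : Prop :=
  [/\ r1 * r1 = a1 * r1 + a2 * r2, r1 * r2 = b1 * r1 + b2 * r2,
      r2 * r1 = c1 * r1 + c2 * r2 & r2 * r2 = d1 * r1 + d2 * r2].

Definition odd_square (a1 a2 b1 b2 c1 c2 d1 d2 l1 l2 r1 r2 s1 s2 : CC) : Prop :=
  [/\ [/\ l1 * s1 = s1 * a1 + s2 * b1, l1 * s2 = s1 * a2 + s2 * b2,
      l2 * s1 = s1 * c1 + s2 * d1 & l2 * s2 = s1 * c2 + s2 * d2],
      [/\ r1 * s1 = l1 * s1, r1 * s2 = l1 * s2, r2 * s1 = l2 * s1 & r2 * s2 = l2 * s2],
      [/\ s1 * a1 + s2 * c1 = r1 * s1, s1 * a2 + s2 * c2 = r1 * s2,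
          s1 * b1 + s2 * d1 = r2 * s1 & s1 * b2 + s2 * d2 = r2 * s2]
          & s1 * l1 + s2 * l2 = s1 * r1 + s2 * r2].

(** The equations are sorted by the positions of odd arguments. The condition (e_i f) e_j = e_i (f
    e_j) is automatic because the odd part is one-dimensional. *)
Lemma assoc_mkevenE a1 a2 b1 b2 c1 c2 d1 d2 l1 l2 r1 r2 s1 s2 :
  assoc_str (mkeven a1 a2 b1 b2 c1 c2 d1 d2 l1 l2 r1 r2 s1 s2) <->
  [/\ even_assoc a1 a2 b1 b2 c1 c2 d1 d2, left_module a1 a2 b1 b2 c1 c2 d1 d2 l1 l2,
      right_module a1 a2 b1 b2 c1 c2 d1 d2 r1 r2
    & odd_square a1 a2 b1 b2 c1 c2 d1 d2 l1 l2 r1 r2 s1 s2].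
Proof.
split=> [H|[hE hL hR hS]].
  split; repeat split.
  - by have := H o0 o0 o0 o0; rewrite !sum3 /mkeven /= !simp0.
  - by have := H o0 o0 o0 o1; rewrite !sum3 /mkeven /= !simp0.
  - by have := H o0 o0 o1 o0; rewrite !sum3 /mkeven /= !simp0.
  - by have := H o0 o0 o1 o1; rewrite !sum3 /mkeven /= !simp0.
  - by have := H o0 o1 o0 o0; rewrite !sum3 /mkeven /= !simp0.
  - by have := H o0 o1 o0 o1; rewrite !sum3 /mkeven /= !simp0.
  - by have := H o0 o1 o1 o0; rewrite !sum3 /mkeven /= !simp0.
  - by have := H o0 o1 o1 o1; rewrite !sum3 /mkeven /= !simp0.
  - by have := H o1 o0 o0 o0; rewrite !sum3 /mkeven /= !simp0.
  - by have := H o1 o0 o0 o1; rewrite !sum3 /mkeven /= !simp0.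
  - by have := H o1 o0 o1 o0; rewrite !sum3 /mkeven /= !simp0.
  - by have := H o1 o0 o1 o1; rewrite !sum3 /mkeven /= !simp0.
  - by have := H o1 o1 o0 o0; rewrite !sum3 /mkeven /= !simp0.
  - by have := H o1 o1 o0 o1; rewrite !sum3 /mkeven /= !simp0.
  - by have := H o1 o1 o1 o0; rewrite !sum3 /mkeven /= !simp0.
  - by have := H o1 o1 o1 o1; rewrite !sum3 /mkeven /= !simp0.
  - by have := H o0 o0 o2 o2; rewrite !sum3 /mkeven /= !simp0.
  - by have := H o0 o1 o2 o2; rewrite !sum3 /mkeven /= !simp0.
  - by have := H o1 o0 o2 o2; rewrite !sum3 /mkeven /= !simp0.
  - by have := H o1 o1 o2 o2; rewrite !sum3 /mkeven /= !simp0.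
  - by have := H o2 o0 o0 o2; rewrite !sum3 /mkeven /= !simp0.
  - by have := H o2 o0 o1 o2; rewrite !sum3 /mkeven /= !simp0.
  - by have := H o2 o1 o0 o2; rewrite !sum3 /mkeven /= !simp0.
  - by have := H o2 o1 o1 o2; rewrite !sum3 /mkeven /= !simp0.
  - by have := H o0 o2 o2 o0; rewrite !sum3 /mkeven /= !simp0.
  - by have := H o0 o2 o2 o1; rewrite !sum3 /mkeven /= !simp0.
  - by have := H o1 o2 o2 o0; rewrite !sum3 /mkeven /= !simp0.
  - by have := H o1 o2 o2 o1; rewrite !sum3 /mkeven /= !simp0.
  - by have := H o2 o0 o2 o0; rewrite !sum3 /mkeven /= !simp0.
  - by have := H o2 o0 o2 o1; rewrite !sum3 /mkeven /= !simp0.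
  - by have := H o2 o1 o2 o0; rewrite !sum3 /mkeven /= !simp0.
  - by have := H o2 o1 o2 o1; rewrite !sum3 /mkeven /= !simp0.
  - by have := H o2 o2 o0 o0; rewrite !sum3 /mkeven /= !simp0.
  - by have := H o2 o2 o0 o1; rewrite !sum3 /mkeven /= !simp0.
  - by have := H o2 o2 o1 o0; rewrite !sum3 /mkeven /= !simp0.
  - by have := H o2 o2 o1 o1; rewrite !sum3 /mkeven /= !simp0.
  - by have := H o2 o2 o2 o2; rewrite !sum3 /mkeven /= !simp0.
case: hE => [[? ? ? ?] [? ? ? ?] [? ? ? ?] [? ? ? ?]].
case: hL => [? ? ? ?]; case: hR => [? ? ? ?]; case: hS => [[? ? ? ?] [? ? ? ?] [? ? ? ?] ?].
do 4 apply: ord3P; rewrite !sum3 /mkeven /= ?simp0; first [assumption | ring].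
Qed.

Lemma stdfamily_assoc (i : 'I_13) t : AssSupVar (stdfamily i t).
Proof.
move: i; apply: (@ord13P (fun i => AssSupVar (stdfamily i t))).
all: split; first by exact: even_of_mkeven.
all: rewrite /stdfamily /= /comm_family /comm_mult /left_family /right_family.
all: apply/assoc_mkevenE; repeat split; ring.
Qed.

(** * Classification *)

Section LinearCombination.
Variables (R : comPzRingType).

(** Certificates for consequences of equations: the coefficients are supplied and the remaining
    identity is left to [ring]. *)
Lemma lincomb1 (k A B C D : R) : C = D -> A - B = k * (C - D) -> A = B.
Proof. by move=> ->; rewrite subrr mulr0 => /eqP; rewrite subr_eq0 => /eqP. Qed.

Lemma lincomb2 (k k' A B C D C' D' : R) : C = D -> C' = D' ->
  A - B = k * (C - D) + k' * (C' - D') -> A = B.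
Proof. by move=> -> ->; rewrite !subrr !mulr0 addr0 => /eqP; rewrite subr_eq0 => /eqP. Qed.

Lemma lincomb3 (k k' k'' A B C D C' D' C'' D'' : R) : C = D -> C' = D' -> C'' = D'' ->
  A - B = k * (C - D) + k' * (C' - D') + k'' * (C'' - D'') -> A = B.
Proof.
by move=> -> -> ->; rewrite !subrr !mulr0 !addr0 => /eqP; rewrite subr_eq0 => /eqP.
Qed.

End LinearCombination.

(** A certificate with division by [k]. With [erefl 0] for [C = D] it merely multiplies the goal by
    [k], leaving [k * (A - B) = 0 - 0]. *)
Lemma cancel_neq0 (k A B C D : CC) : k <> 0 -> C = D -> k * (A - B) = C - D -> A = B.
Proof.
move=> /eqP k0 ->; rewrite subrr => /eqP; rewrite mulf_eq0 (negPf k0) subr_eq0.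
by move/eqP.
Qed.

(** An element commutes with its square, so without commutativity e_1 e_1 and e_2 e_2 lie on the
    lines of e_1 and e_2. The two alternatives are x y = phi(x) y and x y = phi(y) x with phi =
    [(p, q)]. *)
Lemma even_assoc_noncomm a1 a2 b1 b2 c1 c2 d1 d2 :
  even_assoc a1 a2 b1 b2 c1 c2 d1 d2 -> ~ (b1 = c1 /\ b2 = c2) ->
  exists p q, [/\ p <> 0 \/ q <> 0, a2 = 0 /\ d1 = 0, a1 = p, d2 = q
    & [/\ b1 = 0, b2 = p, c1 = q & c2 = 0] \/ [/\ b1 = q, b2 = 0, c1 = 0 & c2 = p]].
Proof.
move=> [[A0 A1 A2 A3] [B0 _ B2 _] [C0 C1 _ C3] [D0 _ D2 D3]] nc.
have a20 : a2 = 0.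
  apply: NNPP => a0; apply: nc.
  split; [apply: (cancel_neq0 a0 (esym A0)) | apply: (cancel_neq0 a0 (esym A1))]; ring.
have d10 : d1 = 0.
  apply: NNPP => d0; apply: nc.
  split; [apply: (cancel_neq0 d0 D2) | apply: (cancel_neq0 d0 D3)]; ring.
subst a2 d1.
have [b20|b20] := classic (b2 = 0); last first.
  have b2E : b2 = a1 by apply: (cancel_neq0 b20 (esym A3)); ring.
  have b10 : b1 = 0 by apply: (cancel_neq0 b20 (esym A2)); ring.
  subst b1 b2.
  have [c20|c20] := classic (c2 = 0); last first.
    case: nc; split; first by apply: esym; apply: (cancel_neq0 c20 C0); ring.
    by apply: esym; apply: (cancel_neq0 c20 C1); ring.
  subst c2; have c1E : c1 = d2 by apply: (cancel_neq0 b20 C3); ring.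
  by exists a1, d2; split=> //; left.
subst b2; have [c20|c20] := classic (c2 = 0); last first.
  have c2E : c2 = a1 by apply: (cancel_neq0 c20 C1); ring.
  have c10 : c1 = 0 by apply: (cancel_neq0 c20 C0); ring.
  subst c1 c2; have b1E : b1 = d2 by apply: (cancel_neq0 c20 (esym C3)); ring.
  by exists a1, d2; split=> //; [left | right].
subst c2.
have bc : b1 - c1 <> 0 by move=> /eqP; rewrite subr_eq0 => /eqP E; apply: nc.
have a10 : a1 = 0 by apply: (cancel_neq0 bc B0); ring.
subst a1; exists 0, d2.
have [b10|b10] := classic (b1 = 0).
  subst b1; have c10 : c1 <> 0 by move=> E; apply: nc; rewrite E.
  have c1E : d2 = c1 by apply: (cancel_neq0 c10 D0); ring.
  by subst d2; split=> //; [right | left].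
have b1E : b1 = d2 by apply: (cancel_neq0 b10 B2); ring.
subst d2; split=> //; first by right.
right; split=> //; apply: NNPP => c10; apply: nc; split=> //.
by apply: (cancel_neq0 c10 D0); ring.
Qed.

(** The equations read phi_i l_j = l_i l_j; a nonzero l_j can be cancelled. *)
Lemma plane_character (p q l1 l2 : CC) :
  [/\ p * l1 = l1 * l1, p * l2 = l1 * l2, q * l1 = l2 * l1 & q * l2 = l2 * l2] ->
  (l1 = 0 * p /\ l2 = 0 * q) \/ (l1 = 1 * p /\ l2 = 1 * q).
Proof.
rewrite !mul0r !mul1r => -[e1 e2 e3 e4].
have [l10|l10] := classic (l1 = 0); last first.
  right; split; apply: esym; first by apply: (cancel_neq0 l10 e1); ring.
  by apply: (cancel_neq0 l10 e3); ring.
have [l20|l20] := classic (l2 = 0); first by left.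
right; split; apply: esym; first by apply: (cancel_neq0 l20 e2); ring.
by apply: (cancel_neq0 l20 e4); ring.
Qed.

(** The equations say phi(x) s = phi(s) x, that is, the odd square is central. If s were nonzero, an
    x independent of s would give phi(x) = phi(s) = 0, hence phi = 0. *)
Lemma plane_square (p q s1 s2 : CC) : p <> 0 \/ q <> 0 ->
  [/\ p * s1 = p * s1 + q * s2, p * s2 = 0, q * s1 = 0 & q * s2 = p * s1 + q * s2] ->
  s1 = 0 /\ s2 = 0.
Proof.
move=> pq [e1 e2 e3 e4]; case: pq => [p0|q0]; split.
- by apply: (cancel_neq0 p0 (esym e4)); ring.
- by apply: (cancel_neq0 p0 e2); ring.
- by apply: (cancel_neq0 q0 e3); ring.
- by apply: (cancel_neq0 q0 (esym e1)); ring.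
Qed.

(** [m1], [m2], [m3] are the 2 x 2 minors of the matrix behind [comm_mult]. A nonzero entry in its
    first row allows [al = 1]; if that row vanishes, [al = 0] and [be = 1]. *)
Lemma even_assoc_comm a1 a2 b1 b2 d1 d2 :
  even_assoc a1 a2 b1 b2 b1 b2 d1 d2 ->
  exists al be x y z, [/\ a1 = al * z + be * x, a2 = al * x,
    b1 = al * y /\ b2 = be * x, d1 = be * y & d2 = al * y - be * z].
Proof.
move=> [[_ _ A2 A3] [_ _ B2 B3] _ _].
pose u := a1 - b2; pose v := b1 - d2.
have m1 : a2 * d1 = b1 * b2 by apply: (lincomb1 (k := 1) A2); ring.
have m2 : a2 * v = b2 * u by apply: (lincomb1 (k := -1) A3); rewrite /u /v; ring.
have m3 : b1 * v = d1 * u by apply: (lincomb1 (k := 1) B2); rewrite /u /v; ring.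
have [a20|a20] := classic (a2 = 0); last first.
  exists 1, (b2 / a2), a2, b1, u; rewrite /u; split; [|ring|split|..]; try ring.
  - by field; exact/eqP.
  - by field; exact/eqP.
  - by apply: (cancel_neq0 a20 m1); field; exact/eqP.
  - by apply: (cancel_neq0 a20 (esym m2)); rewrite /u /v; field; exact/eqP.
have [b10|b10] := classic (b1 = 0); last first.
  have b20 : b2 = 0 by apply: (cancel_neq0 b10 (esym m1)); rewrite a20; ring.
  exists 1, (d1 / b1), a2, b1, u; rewrite /u a20 b20; split; [|ring|split|..]; try ring.
  - by field; exact/eqP.
  - by apply: (cancel_neq0 b10 (esym m3)); rewrite /u /v b20; field; exact/eqP.
have [u0|u0] := classic (u = 0); last first.
  have b20 : b2 = 0 by apply: (cancel_neq0 u0 (esym m2)); rewrite a20; ring.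
  have d10 : d1 = 0 by apply: (cancel_neq0 u0 (esym m3)); rewrite b10; ring.
  exists 1, (v / u), a2, b1, u; rewrite a20 b10 b20 d10; split; [|ring|split|..]; try ring.
  - by rewrite /u b20; ring.
  - by transitivity (- v); [rewrite /v b10; ring | field; exact/eqP].
exists 0, 1, b2, d1, v; rewrite a20 b10; split; [|ring|split|..]; try ring.
- by apply: (lincomb1 (k := 1) u0); rewrite /u; ring.
- by rewrite /v b10; ring.
Qed.

(* A binary form x be^2 + z al be - y al^2 vanishing at [(u, v)] is divisible by [be u - al v]. *)
Lemma form_split (x y z u v : CC) : u <> 0 \/ v <> 0 ->
  x * v * v + z * u * v - y * u * u = 0 ->
  exists m' n', [/\ x = u * m', y = - (v * n') & z = - (u * n' + v * m')].
Proof.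
have [u0|u0 _] := classic (u = 0) => [[//|v0]|] E; last first.
  exists (x / u), (- (z + v * x / u) / u); split.
  - by field; exact/eqP.
  - apply: (cancel_neq0 u0 (erefl 0)); apply: (cancel_neq0 u0 (esym E)).
    by rewrite subrr; field; exact/eqP.
  - by field; exact/eqP.
subst u; have x0 : x = 0.
  apply: (cancel_neq0 v0 (erefl 0)); apply: (cancel_neq0 v0 E).
  by rewrite subrr; ring.
exists (- z / v), (- y / v); rewrite x0; split.
- by ring.
- by field; exact/eqP.
- by field; exact/eqP.
Qed.

Lemma form_root (x y z : CC) :
  exists u v, (u <> 0 \/ v <> 0) /\ x * v * v + z * u * v - y * u * u = 0.
Proof.
have [x0|x0] := classic (x = 0).
  by exists 0, 1; split; [right; apply/eqP/oner_neq0 | rewrite x0; ring].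
(* The quadratic formula for v / u, cleared of its denominator 2x. *)
exists (x *+ 2), (sqrtC (z ^+ 2 + x * y *+ 4) - z); split.
  by left; apply/eqP; rewrite mulrn_eq0 /=; apply/eqP.
have E := sqrtCK (z ^+ 2 + x * y *+ 4).
by apply: (lincomb1 (k := x) E); ring.
Qed.

Section Characters.

Variables (al be x y z : CC).

Definition comm_character (l1 l2 : CC) :=
  [/\ l1 * l1 = (al * z + be * x) * l1 + al * x * l2, l1 * l2 = al * y * l1 + be * x * l2
    & l2 * l2 = be * y * l1 + (al * y - be * z) * l2].

(** A nonzero character is a zero of the binary form, since [al] and [be] times its value there are
    combinations of the character equations. Those equations then also fix the scale of the
    cofactor, which makes K = 1. *)
Lemma character_split l1 l2 : comm_character l1 l2 -> l1 <> 0 \/ l2 <> 0 ->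
  exists m' n', [/\ x = l1 * m', y = - (l2 * n'), z = - (l1 * n' + l2 * m')
    & be * m' - al * n' = 1].
Proof.
move=> [e1 e2 e3] nz.
have f1 : al * (x * l2 * l2 + z * l1 * l2 - y * l1 * l1) = 0.
  by apply: (lincomb2 (k := - l2) (k' := l1) e1 e2); ring.
have f2 : be * (x * l2 * l2 + z * l1 * l2 - y * l1 * l1) = 0.
  by apply: (lincomb2 (k := - l2) (k' := l1) e2 e3); ring.
have E : x * l2 * l2 + z * l1 * l2 - y * l1 * l1 = 0.
  have [al0|al0] := classic (al = 0); last first.
    by apply: (cancel_neq0 al0 f1); ring.
  have [be0|be0] := classic (be = 0); last first.
    by apply: (cancel_neq0 be0 f2); ring.
  have l10 : l1 = 0.
    apply: NNPP => l10; apply: (l10).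
    by apply: (cancel_neq0 l10 e1); rewrite al0 be0; ring.
  have l20 : l2 = 0.
    apply: NNPP => l20; apply: (l20).
    by apply: (cancel_neq0 l20 e3); rewrite al0 be0; ring.
  by rewrite l10 l20; ring.
have [m' [n' [xE yE zE]]] := form_split nz E; exists m', n'; split=> //.
case: nz => nz; apply: (cancel_neq0 nz (erefl 0)); apply: (cancel_neq0 nz (erefl 0)); rewrite subrr.
  by apply: (lincomb1 (k := -1) e1); rewrite xE zE; ring.
by apply: (lincomb1 (k := -1) e3); rewrite yE zE; ring.
Qed.

(** Both characters are zeros of the same form, so (l1, l2) is proportional to (r1, r2) or to
    [(m', n')]. The first case forces equality; in the second the scale comes from the value of the
    form at [(al, be)]. *)
Lemma character_pair l1 l2 r1 r2 m' n' :
  comm_character l1 l2 -> l1 <> 0 \/ l2 <> 0 -> comm_character r1 r2 -> r1 <> 0 \/ r2 <> 0 ->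
  ~ (l1 = r1 /\ l2 = r2) ->
  x = r1 * m' -> y = - (r2 * n') -> z = - (r1 * n' + r2 * m') -> be * m' - al * n' = 1 ->
  l1 = (be * r1 - al * r2) * m' /\ l2 = (be * r1 - al * r2) * n'.
Proof.
move=> cl nl [f1 f2 f3] nr ne xE yE zE K1.
have [m [n [xE' yE' zE' K2]]] := character_split cl nl; have [e1 e2 e3] := cl.
have K : be * l1 - al * l2 = be * r1 - al * r2.
  transitivity ((be * r1 - al * r2) * (be * m' - al * n')); last by rewrite K1 mulr1.
  transitivity (x * be * be + z * al * be - y * al * al); last by rewrite xE yE zE; ring.
  transitivity ((be * l1 - al * l2) * (be * m - al * n)); first by rewrite K2 mulr1.
  by rewrite xE' yE' zE'; ring.
have F : (r1 * l2 - r2 * l1) * (m' * l2 - n' * l1) = 0.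
  transitivity (x * l2 * l2 + z * l1 * l2 - y * l1 * l1); first by rewrite xE yE zE; ring.
  by rewrite xE' yE' zE'; ring.
have [F0|F0] := classic (m' * l2 - n' * l1 = 0).
  rewrite -K; split.
    by apply: (lincomb2 (k := - l1) (k' := al) K1 F0); ring.
  by apply: (lincomb2 (k := - l2) (k' := be) K1 F0); ring.
have G0 : r1 * l2 - r2 * l1 = 0 by apply: (cancel_neq0 F0 F); ring.
case: ne; case: nr => nr.
  have E : r1 * l1 * (l1 - r1) = 0.
    by apply: (lincomb3 (k := r1) (k' := - l1) (k'' := al * x) e1 f1 G0); ring.
  have l10 : l1 <> 0.
    move=> l10; have l20 : l2 = 0 by apply: (cancel_neq0 nr G0); rewrite l10; ring.
    by case: nl.
  have lr : l1 = r1 by apply: (cancel_neq0 l10 (erefl 0)); rewrite subrr; apply: (cancel_neq0 nr E); ring.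
  by split=> //; apply: (cancel_neq0 nr G0); rewrite lr; ring.
have E : r2 * l2 * (l2 - r2) = 0.
  by apply: (lincomb3 (k := r2) (k' := - l2) (k'' := - (be * y)) e3 f3 G0); ring.
have l20 : l2 <> 0.
  move=> l20; have l10 : l1 = 0 by apply: (cancel_neq0 nr (esym G0)); rewrite l20; ring.
  by case: nl.
have lr : l2 = r2 by apply: (cancel_neq0 l20 (erefl 0)); rewrite subrr; apply: (cancel_neq0 nr E); ring.
by split=> //; apply: (cancel_neq0 nr (esym G0)); rewrite lr; ring.
Qed.

End Characters.

(** [P], [Q] and [P'], [Q'] are the coordinates of s e_1 and s e_2: the vector s is an eigenvector
    with eigenvalues l and also r, hence l = r unless s = 0. *)
Lemma comm_in_family al be x y z l1 l2 r1 r2 s1 s2 :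
  comm_character al be x y z l1 l2 -> comm_character al be x y z r1 r2 ->
  let P := s1 * (al * z + be * x) + s2 * (al * y) in
  let Q := s1 * (al * x) + s2 * (be * x) in
  let P' := s1 * (al * y) + s2 * (be * y) in
  let Q' := s1 * (be * x) + s2 * (al * y - be * z) in
  [/\ l1 * s1 = P, l1 * s2 = Q, l2 * s1 = P' & l2 * s2 = Q'] ->
  [/\ r1 * s1 = P, r1 * s2 = Q, r2 * s1 = P' & r2 * s2 = Q'] ->
  exists (i : 'I_13) t, comm_mult al be x y z l1 l2 r1 r2 s1 s2 = stdfamily i t.
Proof.
move=> cl cr P Q P' Q' [e1 e2 e3 e4] [f1 f2 f3 f4].
have [s0|s0] := classic (s1 <> 0 \/ s2 <> 0).
  have [rE1 rE2] : r1 = l1 /\ r2 = l2.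
    split; case: s0 => s0; apply: (cancel_neq0 s0 (erefl 0)).
    - by apply: (lincomb2 (k := 1) (k' := -1) f1 e1); ring.
    - by apply: (lincomb2 (k := 1) (k' := -1) f2 e2); ring.
    - by apply: (lincomb2 (k := 1) (k' := -1) f3 e3); ring.
    - by apply: (lincomb2 (k := 1) (k' := -1) f4 e4); ring.
  subst r1 r2; exists (@Ordinal 13 1 isT).
  (* In the family s = c (n', -m'). Taking c = 1 makes (m', n') = (-s2, s1), which must therefore be
     a zero of the form. *)
  have ns0 : - s2 <> 0 \/ s1 <> 0.
    by case: s0 => s0; [right | left => /eqP; rewrite oppr_eq0 => /eqP].
  have F : al * (x * s1 * s1 + z * - s2 * s1 - y * - s2 * - s2) = 0.
    by apply: (lincomb2 (k := s2) (k' := - s1) e1 e2); rewrite /P /Q; ring.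
  have F' : be * (x * s1 * s1 + z * - s2 * s1 - y * - s2 * - s2) = 0.
    by apply: (lincomb2 (k := s2) (k' := - s1) e3 e4); rewrite /P' /Q'; ring.
  have [[al0 be0]|ab] := classic (al = 0 /\ be = 0).
    have [l10 l20] : l1 = 0 /\ l2 = 0.
      split; case: s0 => s0; apply: (cancel_neq0 s0 (erefl 0)).
      - by apply: (lincomb1 (k := 1) e1); rewrite /P al0 be0; ring.
      - by apply: (lincomb1 (k := 1) e2); rewrite /Q al0 be0; ring.
      - by apply: (lincomb1 (k := 1) e3); rewrite /P' al0 be0; ring.
      - by apply: (lincomb1 (k := 1) e4); rewrite /Q' al0 be0; ring.
    exists (mkenv [:: 0; 0; 0; s1; 1; 0; - s2]).
    by rewrite /stdfamily /= /comm_family /comm_mult /mkenv /= al0 be0 l10 l20; congr mkeven; ring.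
  have E : x * s1 * s1 + z * - s2 * s1 - y * - s2 * - s2 = 0.
    have [al0|al0] := classic (al = 0); last by apply: (cancel_neq0 al0 F); ring.
    have [be0|be0] := classic (be = 0); last by apply: (cancel_neq0 be0 F'); ring.
    by case: ab.
  have [m [n [xE yE zE]]] := form_split ns0 E.
  have [l1E l2E] : l1 = (be * - s2 - al * s1) * m /\ l2 = (be * - s2 - al * s1) * n.
    split; case: s0 => s0; apply: (cancel_neq0 s0 (erefl 0)).
    - by apply: (lincomb1 (k := 1) e1); rewrite /P xE yE zE; ring.
    - by apply: (lincomb1 (k := 1) e2); rewrite /Q xE; ring.
    - by apply: (lincomb1 (k := 1) e3); rewrite /P' yE; ring.
    - by apply: (lincomb1 (k := 1) e4); rewrite /Q' xE yE zE; ring.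
  exists (mkenv [:: al; be; n; s1; 1; m; - s2]).
  by rewrite /stdfamily /= /comm_family /comm_mult /mkenv /= l1E l2E xE yE zE; congr mkeven; ring.
have [s10 s20] : s1 = 0 /\ s2 = 0 by split; apply: NNPP => ns; apply: s0; [left | right].
rewrite s10 s20 {e1 e2 e3 e4 f1 f2 f3 f4 s0 P Q P' Q'}.
have zeroP (u v : CC) : ~ (u <> 0 \/ v <> 0) -> u = 0 /\ v = 0.
  by move=> h; split; apply: NNPP => nu; apply: h; [left | right].
(* With s = 0 the parameter c is 0. A nonzero character, r if possible, serves as (m, n), and K = 1
   makes it L. *)
have [l0|/zeroP [l10 l20]] := classic (l1 <> 0 \/ l2 <> 0);
have [r0|/zeroP [r10 r20]] := classic (r1 <> 0 \/ r2 <> 0).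
- have [[lr1 lr2]|ne] := classic (l1 = r1 /\ l2 = r2).
    have [m' [n' [xE yE zE K]]] := character_split cr r0.
    exists (@Ordinal 13 1 isT), (mkenv [:: al; be; r2; n'; 0; r1; m']).
    by rewrite /stdfamily /= /comm_family /comm_mult /mkenv /= K lr1 lr2 xE yE zE; congr mkeven; ring.
  have [m' [n' [xE yE zE K]]] := character_split cr r0.
  have [l1E l2E] := character_pair cl l0 cr r0 ne xE yE zE K.
  exists (@Ordinal 13 4 isT), (mkenv [:: al; be; r2; n'; 0; r1; m']).
  by rewrite /stdfamily /= /comm_family /comm_mult /mkenv /= K l1E l2E xE yE zE; congr mkeven; ring.
- have [m' [n' [xE yE zE K]]] := character_split cl l0.
  exists (@Ordinal 13 3 isT), (mkenv [:: al; be; l2; n'; 0; l1; m']).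
  by rewrite /stdfamily /= /comm_family /comm_mult /mkenv /= K r10 r20 xE yE zE; congr mkeven; ring.
- have [m' [n' [xE yE zE K]]] := character_split cr r0.
  exists (@Ordinal 13 2 isT), (mkenv [:: al; be; r2; n'; 0; r1; m']).
  by rewrite /stdfamily /= /comm_family /comm_mult /mkenv /= K l10 l20 xE yE zE; congr mkeven; ring.
have [u [v [uv0 E]]] := form_root x y z.
have [m' [n' [xE yE zE]]] := form_split uv0 E.
exists (@Ordinal 13 0 isT), (mkenv [:: al; be; v; n'; 0; u; m']).
by rewrite /stdfamily /= /comm_family /comm_mult /mkenv /= l10 l20 r10 r20 xE yE zE; congr mkeven; ring.
Qed.

Lemma AssSupVar_family mu : AssSupVar mu -> exists (i : 'I_13) t, mu = stdfamily i t.
Proof.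
move=> [/even_mkeven muE]; move: muE.
move: (mu o0 o0 o0) (mu o0 o0 o1) (mu o0 o1 o0) (mu o0 o1 o1) => a1 a2 b1 b2.
move: (mu o1 o0 o0) (mu o1 o0 o1) (mu o1 o1 o0) (mu o1 o1 o1) => c1 c2 d1 d2.
move: (mu o0 o2 o2) (mu o1 o2 o2) (mu o2 o0 o2) (mu o2 o1 o2) => l1 l2 r1 r2.
move: (mu o2 o2 o0) (mu o2 o2 o1) => s1 s2 -> /assoc_mkevenE [hE].
case=> [L1 L2 L3 L4] [R1 R2 R3 R4] [[S1 S2 S3 S4] [T1 T2 T3 T4] [U1 U2 U3 U4] _].
have [[bc1 bc2]|nc] := classic (b1 = c1 /\ b2 = c2).
  subst c1 c2; have [al [be [x [y [z [e1 e2 [e3 e4] e5 e6]]]]]] := even_assoc_comm hE.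
  subst a1 a2 b1 b2 d1 d2.
  by apply: comm_in_family; split=> //; apply: esym.
have [p [q [pq [a20 d10] a1E d2E form]]] := even_assoc_noncomm hE nc.
subst a2 d1 a1 d2; case: form => -[? ? ? ?]; subst b1 b2 c1 c2.
- have [s10 s20] : s1 = 0 /\ s2 = 0.
    apply: (plane_square pq); split.
    + by rewrite -[RHS](_ : s1 * p + s2 * q = _); [rewrite U1 T1 S1 |]; ring.
    + by transitivity (l1 * s2); [rewrite S2; ring | rewrite -T2 -U2; ring].
    + by transitivity (l2 * s1); [rewrite S3; ring | rewrite -T3 -U3; ring].
    + by transitivity (l2 * s2); [rewrite S4; ring | rewrite -T4 -U4; ring].
  have lE : (l1 = 0 * p /\ l2 = 0 * q) \/ (l1 = 1 * p /\ l2 = 1 * q).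
    by apply: plane_character; split;
      [rewrite -L1 | rewrite [RHS]mulrC -L2 | rewrite [RHS]mulrC -L3 | rewrite -L4]; ring.
  have rE : (r1 = 0 * p /\ r2 = 0 * q) \/ (r1 = 1 * p /\ r2 = 1 * q).
    by apply: plane_character; split; [rewrite R1|rewrite R2|rewrite R3|rewrite R4]; ring.
  case: lE rE => -[-> ->] [] [-> ->]; rewrite s10 s20.
  + by exists (@Ordinal 13 5 isT), (mkenv [:: p; q]).
  + by exists (@Ordinal 13 8 isT), (mkenv [:: p; q]).
  + by exists (@Ordinal 13 10 isT), (mkenv [:: p; q]).
  + by exists (@Ordinal 13 12 isT), (mkenv [:: p; q]).
- have [s10 s20] : s1 = 0 /\ s2 = 0.
    apply: (plane_square pq); split.
    + by transitivity (r1 * s1); [rewrite -U1 | rewrite T1 S1]; ring.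
    + by transitivity (r1 * s2); [rewrite -U2 | rewrite T2 S2]; ring.
    + by transitivity (r2 * s1); [rewrite -U3 | rewrite T3 S3]; ring.
    + by transitivity (r2 * s2); [rewrite -U4 | rewrite T4 S4]; ring.
  have lE : (l1 = 0 * p /\ l2 = 0 * q) \/ (l1 = 1 * p /\ l2 = 1 * q).
    by apply: plane_character; split; [rewrite -L1|rewrite -L3|rewrite -L2|rewrite -L4]; ring.
  have rE : (r1 = 0 * p /\ r2 = 0 * q) \/ (r1 = 1 * p /\ r2 = 1 * q).
    by apply: plane_character; split;
      [rewrite R1 | rewrite [RHS]mulrC R3 | rewrite [RHS]mulrC R2 | rewrite R4]; ring.
  case: lE rE => -[-> ->] [] [-> ->]; rewrite s10 s20.
  + by exists (@Ordinal 13 6 isT), (mkenv [:: p; q]).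
  + by exists (@Ordinal 13 9 isT), (mkenv [:: p; q]).
  + by exists (@Ordinal 13 7 isT), (mkenv [:: p; q]).
  + by exists (@Ordinal 13 11 isT), (mkenv [:: p; q]).
Qed.

(** * Orbits inside the families *)

Definition comm_rep (u1 u2 v1 v2 k : CC) := mkeven 1 0 0 0 0 0 0 1 u1 u2 v1 v2 k 0.
Definition left_rep (u v : CC) := mkeven 1 0 0 1 0 0 0 0 u 0 v 0 0 0.
Definition right_rep (u v : CC) := mkeven 1 0 0 0 0 1 0 0 u 0 v 0 0 0.

Definition representative (i : nat) : struct :=
  nth (mkeven 0 0 0 0 0 0 0 0 0 0 0 0 0 0)
   [:: comm_rep 0 0 0 0 0; comm_rep 1 0 1 0 1; comm_rep 0 0 1 0 0;
       comm_rep 1 0 0 0 0; comm_rep 0 1 1 0 0;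
       left_rep 0 0; right_rep 0 0; right_rep 1 0; left_rep 0 1;
       right_rep 0 1; left_rep 1 0; right_rep 1 1; left_rep 1 1] i.

Lemma Ralg_representative (i : 'I_13) : Ralg i = representative i.
Proof.
rewrite /Ralg; move: i.
by apply: (@ord13P (fun i => mkstr (nth [::] Rtable i) = representative i));
  apply: structP; do 3 apply: ord3P.
Qed.

(** The determinant of L and L'. *)
Definition disc (t : env) : CC :=
  let al := t 0%N in let be := t 1%N in let n := t 2%N in let n' := t 3%N in
  let m := t 5%N in let m' := t 6%N in
  (be * m' - al * n') * (be * m - al * n) * (m * n' - n * m').

Definition nondegenerate (i : nat) (t : env) : Prop :=
  if (i < 5)%N then disc t <> 0 /\ (i = 1%N -> t 4%N <> 0) else t 0%N <> 0 \/ t 1%N <> 0.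

(** The rows of the even block are L and L': the pair of characters maps the even part to C x C. As
    L'(s) = 0, only L(s) has to match z^2. *)
Lemma comm_family_hom u1 u2 v1 v2 k t z :
  let al := t 0%N in let be := t 1%N in let n := t 2%N in let n' := t 3%N in
  let c := t 4%N in let m := t 5%N in let m' := t 6%N in
  let K := be * m' - al * n' in let K' := be * m - al * n in
  k * (z * z) = k * (c * K * (m * n' - n * m')) ->
  homstr (blk (K * m) (K * n) (K' * m') (K' * n') z)
    (comm_family u1 u2 v1 v2 k t) (comm_rep u1 u2 v1 v2 k).
Proof.
move=> al be n n' c m m' K K' E.
rewrite /comm_family /comm_mult /comm_rep -/al -/be -/n -/n' -/c -/m -/m' -/K -/K'.
apply: hom_mkeven; do ?split; rewrite /K /K'; try ring.
by transitivity (k * (z * z)); [rewrite E /K | ]; ring.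
Qed.

(** The whole structure is determined by phi, so every completion of the row phi is a
    homomorphism. *)
Lemma left_family_hom u v t a b z :
  homstr (blk (t 0%N) (t 1%N) a b z) (left_family u v t) (left_rep u v).
Proof. by apply: hom_mkeven; do ?split; ring. Qed.

Lemma right_family_hom u v t a b z :
  homstr (blk (t 0%N) (t 1%N) a b z) (right_family u v t) (right_rep u v).
Proof. by apply: hom_mkeven; do ?split; ring. Qed.

Lemma complete_row (p q : CC) : p <> 0 \/ q <> 0 -> exists a b, p * b - q * a != 0.
Proof.
case=> /eqP h; first by exists 0, 1; rewrite mulr0 subr0 mulr1.
by exists (- 1), 0; rewrite mulr0 sub0r mulrN mulr1 opprK.
Qed.

Lemma comm_family_orbit u1 u2 v1 v2 k t :
  disc t <> 0 -> (k <> 0 -> t 4%N <> 0) ->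
  sorbit (comm_rep u1 u2 v1 v2 k) (comm_family u1 u2 v1 v2 k t).
Proof.
move=> d0 c0; apply/sorbitP.
have [z z0 E] : exists2 z : CC, z != 0 & k * (z * z) =
    k * (t 4%N * (t 1%N * t 6%N - t 0%N * t 3%N) * (t 5%N * t 3%N - t 2%N * t 6%N)).
  have [k0|k0] := classic (k = 0); first by exists 1; rewrite ?oner_neq0 // k0 !mul0r.
  set y := t 4%N * _ * _.
  have y0 : y <> 0.
    move=> y0; apply: d0; apply: (cancel_neq0 (c0 k0) (erefl 0)).
    transitivity (y * (t 1%N * t 5%N - t 0%N * t 2%N)); first by rewrite /disc /y; ring.
    by rewrite y0; ring.
  by exists (sqrtC y); [rewrite sqrtC_eq0; apply/eqP | rewrite -expr2 sqrtCK].
eexists; last exact: comm_family_hom E.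
apply: blk_grGL => //; apply/eqP => D0; apply: d0.
by rewrite -D0 /disc; ring.
Qed.

Lemma left_family_orbit u v t :
  t 0%N <> 0 \/ t 1%N <> 0 -> sorbit (left_rep u v) (left_family u v t).
Proof.
move=> /complete_row [a [b D0]]; apply/sorbitP.
by eexists; [apply: blk_grGL D0 (oner_neq0 _) | exact: left_family_hom].
Qed.

Lemma right_family_orbit u v t :
  t 0%N <> 0 \/ t 1%N <> 0 -> sorbit (right_rep u v) (right_family u v t).
Proof.
move=> /complete_row [a [b D0]]; apply/sorbitP.
by eexists; [apply: blk_grGL D0 (oner_neq0 _) | exact: right_family_hom].
Qed.

Lemma nondegenerate_orbit (i : 'I_13) t :
  nondegenerate i t -> sorbit (Ralg i) (stdfamily i t).
Proof.
rewrite Ralg_representative; move: i.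
apply: (@ord13P (fun i => nondegenerate i t -> sorbit (representative i) (stdfamily i t))).
all: rewrite /nondegenerate /representative /stdfamily /=.
1-5: by move=> [d0 c0]; apply: comm_family_orbit => // _; exact: c0.
all: by [exact: left_family_orbit | exact: right_family_orbit].
Qed.

Lemma comm_orbit_family u1 u2 v1 v2 k nu : sorbit (comm_rep u1 u2 v1 v2 k) nu ->
  exists2 t, disc t <> 0 /\ t 4%N <> 0 & nu = comm_family u1 u2 v1 v2 k t.
Proof.
move=> /sorbitP [h hG H]; have [p1 [p2 [q1 [q2 [z [hE D0 z0]]]]]] := grGL_blk hG.
set D := p1 * q2 - p2 * q1 in D0 *.
(* The rows of the block become (m, n) and (m', n'); [al] and [be] solve K = K' = 1, and c is
   determined by z^2 = c D. *)
pose t := mkenv [:: (q1 - p1) / D; (q2 - p2) / D; p2; q2; z * z / D; p1; q1].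
have K1 : t 1%N * t 6%N - t 0%N * t 3%N = 1 by rewrite /t /mkenv /= /D; field.
have K2 : t 1%N * t 5%N - t 0%N * t 2%N = 1 by rewrite /t /mkenv /= /D; field.
exists t; first split.
- by rewrite /disc; cbv zeta; rewrite K1 K2 !mul1r; apply/eqP.
- by apply/eqP; rewrite /t /mkenv /= !mulf_neq0 // invr_neq0.
apply: (homstr_inj _ H); first exact: hG.1.
have := @comm_family_hom u1 u2 v1 v2 k t z; cbv zeta; rewrite K1 K2 !mul1r hE; apply.
by rewrite /t /mkenv /= /D; field.
Qed.

Lemma left_orbit_family u v nu : sorbit (left_rep u v) nu ->
  exists2 t, t 0%N <> 0 \/ t 1%N <> 0 & nu = left_family u v t.
Proof.
move=> /sorbitP [h hG H]; have [p1 [p2 [q1 [q2 [z [hE D0 z0]]]]]] := grGL_blk hG.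
exists (mkenv [:: p1; p2]).
  apply: NNPP => /not_or_and [/NNPP p10 /NNPP p20]; case/eqP: D0.
  by move: p10 p20; rewrite /mkenv /= => -> ->; ring.
apply: (homstr_inj _ H); first exact: hG.1.
by rewrite hE; exact: left_family_hom.
Qed.

Lemma right_orbit_family u v nu : sorbit (right_rep u v) nu ->
  exists2 t, t 0%N <> 0 \/ t 1%N <> 0 & nu = right_family u v t.
Proof.
move=> /sorbitP [h hG H]; have [p1 [p2 [q1 [q2 [z [hE D0 z0]]]]]] := grGL_blk hG.
exists (mkenv [:: p1; p2]).
  apply: NNPP => /not_or_and [/NNPP p10 /NNPP p20]; case/eqP: D0.
  by move: p10 p20; rewrite /mkenv /= => -> ->; ring.
apply: (homstr_inj _ H); first exact: hG.1.
by rewrite hE; exact: right_family_hom.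
Qed.

Lemma orbit_nondegenerate (i : 'I_13) nu :
  sorbit (Ralg i) nu -> exists2 t, nondegenerate i t & nu = stdfamily i t.
Proof.
rewrite Ralg_representative; move: i.
apply: (@ord13P (fun i => sorbit (representative i) nu ->
  exists2 t, nondegenerate i t & nu = stdfamily i t)).
all: rewrite /nondegenerate /representative /stdfamily /=.
1-5: by move=> /comm_orbit_family [t [d0 c0] ->]; exists t.
all: by [exact: left_orbit_family | exact: right_orbit_family].
Qed.

Lemma polmap_stdfamily (i : 'I_13) : polmap (stdfamily i).
Proof.
have Hc u1 u2 v1 v2 k : polmap (comm_family u1 u2 v1 v2 k).
  do 3 apply: ord3P; rewrite /comm_family /comm_mult /mkeven /=;
  repeat first [apply: pol_var | apply: pol_const | apply: pol_add | apply: pol_mul | apply: pol_opp].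
have Hl u v : polmap (left_family u v).
  do 3 apply: ord3P; rewrite /left_family /mkeven /=;
  repeat first [apply: pol_var | apply: pol_const | apply: pol_mul].
have Hr u v : polmap (right_family u v).
  do 3 apply: ord3P; rewrite /right_family /mkeven /=;
  repeat first [apply: pol_var | apply: pol_const | apply: pol_mul].
move: i; apply: (@ord13P (fun i => polmap (stdfamily i))).
all: by [exact: Hc | exact: Hl | exact: Hr].
Qed.

(* The discriminant of the trace form of the even part. *)
Definition even_disc (mu : struct) : CC :=
  let t1 := mu o0 o0 o0 + mu o0 o1 o1 in let t2 := mu o1 o0 o0 + mu o1 o1 o1 in
  let q11 := t1 * mu o0 o0 o0 + t2 * mu o0 o0 o1 in
  let q12 := t1 * mu o0 o1 o0 + t2 * mu o0 o1 o1 in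
  let q22 := t1 * mu o1 o1 o0 + t2 * mu o1 o1 o1 in
  q11 * q22 - q12 * q12.

Lemma polyfun_even_disc : polyfun even_disc.
Proof.
rewrite /even_disc; cbv zeta.
repeat first [apply: pf_coord | apply: pf_add | apply: pf_mul | apply: polyfun_opp].
Qed.

(** [nondegenerate] restricts parameters; openness of the orbit needs equations in the structure
    constants. On the commutative families [even_disc] is the square of [disc]. *)
Definition degenerate (i : nat) (mu : struct) : Prop :=
  if (i < 5)%N then even_disc mu = 0 \/ (i = 1%N /\ mu o2 o2 o0 = 0 /\ mu o2 o2 o1 = 0)
  else mu o0 o0 o0 = 0 /\ mu o1 o1 o1 = 0.

Lemma degenerate_closed i : zclosed (degenerate i).
Proof.
rewrite /degenerate; case: (i < 5)%N; last first.
  by apply: zclosedI; apply: zclosed_zero; exact: pf_coord.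
apply: zclosedU; first exact: zclosed_zero polyfun_even_disc.
have c2 := zclosedI (zclosed_zero (pf_coord o2 o2 o0)) (zclosed_zero (pf_coord o2 o2 o1)).
have [i1|ni] := classic (i = 1%N).
  by apply: (zclosed_ext _ c2) => mu; split=> [//|[]].
by apply: (zclosed_ext _ zclosed_empty) => mu; split=> [//|[]].
Qed.

Lemma degenerateP (i : 'I_13) t : degenerate i (stdfamily i t) <-> ~ nondegenerate i t.
Proof.
have dE u1 u2 v1 v2 k : even_disc (comm_family u1 u2 v1 v2 k t) = disc t * disc t.
  by rewrite /even_disc /comm_family /comm_mult /disc /mkeven /=; ring.
have d0 u1 u2 v1 v2 k : even_disc (comm_family u1 u2 v1 v2 k t) = 0 <-> disc t = 0.
  rewrite dE; split=> [/eqP|->]; last by rewrite mul0r.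
  by rewrite mulf_eq0 orbb => /eqP.
have pq (p q : CC) : p = 0 /\ q = 0 <-> ~ (p <> 0 \/ q <> 0).
  split=> [[-> ->] []//|h].
  by split; apply: NNPP => n0; apply: h; [left | right].
move: i; apply: (@ord13P (fun i => degenerate i (stdfamily i t) <-> ~ nondegenerate i t)).
all: rewrite /degenerate /nondegenerate /stdfamily /=.
2: { rewrite d0; split.
  case=> [dz [] //|[_ [s1 s2]] [dz /(_ erefl) c0]].
    apply: dz; apply: (cancel_neq0 c0 (erefl 0)).
    move: s1 s2; rewrite /comm_family /comm_mult /mkeven /= => s1 s2.
    (* Here c [disc] = K K' (m s1 + n s2). *)
    by apply: (lincomb2 (k := (t 1%N * t 6%N - t 0%N * t 3%N) * (t 1%N * t 5%N - t 0%N * t 2%N) * t 5%N)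
      (k' := (t 1%N * t 6%N - t 0%N * t 3%N) * (t 1%N * t 5%N - t 0%N * t 2%N) * t 2%N) s1 s2);
      rewrite /disc; ring.
  move=> h; have [dz|dz] := classic (disc t = 0); [by left | right].
  have c0 : t 4%N = 0 by apply: NNPP => c0; apply: h; split.
  by rewrite /comm_family /comm_mult /mkeven /= c0; split=> //; split; ring. }
5-12: exact: pq.
all: rewrite d0; split=> [[dz []//|[]//]|h]; left; apply: NNPP => dz; by apply: h.
Qed.

Lemma stdfamily_degenerate_locus (i : 'I_13) : exists2 e : env -> CC, pol e &
  (exists t, e t <> 0) /\ (forall t, e t <> 0 -> nondegenerate i t).
Proof.
case: (ltnP i 5) => hi; last first.
  exists (fun t => t 0%N); first exact: pol_var.
  split; first by exists (fun=> 1); apply/eqP/oner_neq0.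
  by move=> t t0; rewrite /nondegenerate ltnNge hi /=; left.
exists (fun t => disc t * t 4%N).
  rewrite /disc; cbv zeta.
  repeat first [apply: pol_var | apply: pol_add | apply: pol_mul | apply: pol_opp].
split.
  (* At this point L = (1, 0), L' = (0, 1) and c = 1. *)
  exists (mkenv [:: -1; 1; 0; 1; 1; 1; 0]).
  rewrite /disc /mkenv /=; apply/eqP.
  by rewrite (_ : _ * _ = 1) ?oner_neq0 //; ring.
move=> t /eqP; rewrite mulf_eq0 negb_or => /andP[/eqP d0 /eqP c0].
by rewrite /nondegenerate hi.
Qed.

(** * Separating the families *)

Definition vanish_on (fs : seq (struct -> CC)) (mu : struct) : Prop :=
  foldr (fun f P => f mu = 0 /\ P) True fs.

Lemma zclosed_vanish_on fs : foldr (fun f P => polyfun f /\ P) True fs -> zclosed (vanish_on fs).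
Proof.
elim: fs => [_|f fs IH /= [pf /IH cfs]]; last exact: zclosedI (zclosed_zero pf) cfs.
by apply: zclosed_ext (zclosed_zero (pf_const 0)) => mu.
Qed.

(* The characteristic polynomial of left multiplication by [e_1 + e_2], evaluated at [rho mu]. *)
Definition char_poly_at (rho : struct -> CC) (mu : struct) : CC :=
  (mu o0 o0 o0 + mu o1 o0 o0 - rho mu) * (mu o0 o1 o1 + mu o1 o1 o1 - rho mu)
  - (mu o0 o0 o1 + mu o1 o0 o1) * (mu o0 o1 o0 + mu o1 o1 o0).

Definition comm_eqs : seq (struct -> CC) :=
  [:: fun mu => mu o0 o1 o0 - mu o1 o0 o0; fun mu => mu o0 o1 o1 - mu o1 o0 o1].

Definition left_eqs (u v : CC) : seq (struct -> CC) :=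
  [:: fun mu => mu o0 o1 o1 - mu o0 o0 o0; fun mu => mu o0 o2 o2 - u * mu o0 o0 o0;
      fun mu => mu o2 o0 o2 - v * mu o0 o0 o0].

Definition right_eqs (u v : CC) : seq (struct -> CC) :=
  [:: fun mu => mu o1 o0 o1 - mu o0 o0 o0; fun mu => mu o0 o2 o2 - u * mu o0 o0 o0;
      fun mu => mu o2 o0 o2 - v * mu o0 o0 o0].

(** Only the twelve points R_j have to be excluded. Characters are eigenvalues of left
    multiplication, whence [char_poly_at]; it excludes R_01, where l = r = 0 but e_1 + e_2 acts as
    the identity. On the family of R_07, l + r is the trace. *)
Definition separating (i : nat) : seq (struct -> CC) :=
  nth [::]
  [:: comm_eqs ++ [:: fun mu => mu o0 o2 o2; fun mu => mu o1 o2 o2;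
                      fun mu => mu o2 o0 o2; fun mu => mu o2 o2 o0];
      comm_eqs ++ [:: fun mu => mu o0 o2 o2 - mu o2 o0 o2; fun mu => mu o1 o2 o2 - mu o2 o1 o2;
                      char_poly_at (fun mu => mu o0 o2 o2 + mu o1 o2 o2)];
      comm_eqs ++ [:: fun mu => mu o0 o2 o2; fun mu => mu o1 o2 o2; fun mu => mu o2 o2 o0;
                      char_poly_at (fun mu => mu o2 o0 o2 + mu o2 o1 o2)];
      comm_eqs ++ [:: fun mu => mu o2 o0 o2; fun mu => mu o2 o1 o2; fun mu => mu o2 o2 o0;
                      char_poly_at (fun mu => mu o0 o2 o2 + mu o1 o2 o2)];
      comm_eqs ++ [:: fun mu => mu o2 o2 o0;
                      fun mu => mu o0 o2 o2 + mu o2 o0 o2 - (mu o0 o0 o0 + mu o0 o1 o1);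
                      fun mu => mu o1 o2 o2 + mu o2 o1 o2 - (mu o1 o0 o0 + mu o1 o1 o1)];
      left_eqs 0 0; right_eqs 0 0; right_eqs 1 0; left_eqs 0 1;
      right_eqs 0 1; left_eqs 1 0; right_eqs 1 1; left_eqs 1 1] i.

Lemma separating_closed (i : 'I_13) : zclosed (vanish_on (separating i)).
Proof.
apply: zclosed_vanish_on; move: i.
apply: (@ord13P (fun i => foldr (fun f P => polyfun f /\ P) True (separating i))).
all: rewrite /separating /= /char_poly_at; do !split => //.
all: repeat first [apply: pf_coord | apply: pf_const | apply: pf_add | apply: pf_mul | apply: polyfun_opp].
Qed.

Lemma separating_stdfamily (i : 'I_13) t : vanish_on (separating i) (stdfamily i t).
Proof.
move: i; apply: (@ord13P (fun i => vanish_on (separating i) (stdfamily i t))).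
all: rewrite /vanish_on /separating /= /char_poly_at /stdfamily /=.
all: rewrite /comm_family /comm_mult /left_family /right_family /mkeven /=.
all: repeat split; ring.
Qed.

Lemma separating_Ralg (i j : 'I_13) : i != j -> ~ vanish_on (separating i) (Ralg j).
Proof.
rewrite Ralg_representative.
pose Q (i j : nat) := i != j -> ~ vanish_on (separating i) (representative j).
suff H : forall i j : 'I_13, Q i j by move=> ij; exact: H.
pose simp := (@subr0 CC, @sub0r CC, @addr0 CC, @add0r CC, @mulr0 CC, @mul0r CC, @mulr1 CC,
  @mul1r CC, @subrr CC, @oppr0 CC, @oppr_eq0 CC, @oner_eq0 CC).
apply: (@ord13P (fun i => forall j : 'I_13, Q i j)).
all: apply: (@ord13P (Q _)).
all: rewrite /Q.
all: move=> //= _; rewrite /vanish_on /separating /= /char_poly_at /representative /=.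
all: rewrite /comm_rep /left_rep /right_rep /mkeven /=.
all: repeat (case; first [by move/eqP; rewrite ?simp | move=> _]).
Qed.

(** * The irreducible components *)

Lemma AssSupVar_closed : zclosed AssSupVar.
Proof.
pose assoc_poly i j l m (mu : struct) : CC :=
  \sum_(k < 3) mu i j k * mu k l m - \sum_(k < 3) mu j l k * mu i k m.
exists (fun f => (exists i j k, (deg i (+) deg j) != deg k /\ f = fun mu => mu i j k) \/
  exists i j l m, f = assoc_poly i j l m); split.
  move=> f [[i [j [k [_ ->]]]]|[i [j [l [m ->]]]]]; first exact: pf_coord.
  apply: pf_add; last apply: polyfun_opp.
  - by apply: polyfun_sum => k; apply: pf_mul; exact: pf_coord.
  - by apply: polyfun_sum => k; apply: pf_mul; exact: pf_coord.
move=> mu; split.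
  move=> [ev asc] f [[i [j [k [ijk ->]]]]|[i [j [l [m ->]]]]]; first exact: ev.
  by rewrite /assoc_poly asc subrr.
move=> h; split=> [i j k ijk|i j l m].
  by apply: (h (fun mu => mu i j k)); left; exists i, j, k.
have /eqP : assoc_poly i j l m mu = 0 by apply: h; right; exists i, j, l, m.
by rewrite subr_eq0 => /eqP.
Qed.

Lemma orbit_sub_AssSupVar (i : 'I_13) : subset_ (sorbit (Ralg i)) AssSupVar.
Proof. by move=> nu /orbit_nondegenerate [t _ ->]; exact: stdfamily_assoc. Qed.

Lemma closure_orbitE (i : 'I_13) :
  seteq_ (closure_in AssSupVar (sorbit (Ralg i))) (zclosure (sorbit (Ralg i))).
Proof. exact: closure_inE (@orbit_sub_AssSupVar i) AssSupVar_closed. Qed.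

(** Nondegenerate parameters are dense: a polynomial vanishing on the orbit has a pullback whose
    product with [e] is zero. *)
Lemma stdfamily_closure (i : 'I_13) t : zclosure (sorbit (Ralg i)) (stdfamily i t).
Proof.
move=> f pf f0; apply: NNPP => ft.
have [e pe [[t0 e0] nd]] := stdfamily_degenerate_locus i.
have [t' E] := pol_mul_neq0 (pol_comp pf (@polmap_stdfamily i)) pe ft e0.
have [et|et] := classic (e t' = 0); first by apply: E; rewrite et mulr0.
by apply: E; rewrite /= f0 ?mul0r //; apply: nondegenerate_orbit; exact: nd.
Qed.

Lemma closure_orbit_image (i : 'I_13) :
  seteq_ (zclosure (image_of (stdfamily i))) (zclosure (sorbit (Ralg i))).
Proof.
move=> mu; split; apply: zclosure_min; try exact: zclosure_closed.
  by move=> _ [t ->]; exact: stdfamily_closure.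
by move=> nu /orbit_nondegenerate [t _ ->]; apply: sub_zclosure; exists t.
Qed.

Lemma zirreducible_closure_orbit (i : 'I_13) : zirreducible (zclosure (sorbit (Ralg i))).
Proof.
apply: zirreducible_ext (@closure_orbit_image i) _.
by apply: zirreducible_image; exact: polmap_stdfamily.
Qed.

Lemma AssSupVar_cover mu : AssSupVar mu -> exists i : 'I_13, zclosure (sorbit (Ralg i)) mu.
Proof. by move=> /AssSupVar_family [i [t ->]]; exists i; exact: stdfamily_closure. Qed.

Lemma Ralg_notin_closure (i j : 'I_13) : i != j -> ~ zclosure (sorbit (Ralg i)) (Ralg j).
Proof.
move=> ij h; apply: (separating_Ralg ij).
apply: zclosure_min h; first exact: separating_closed.
by move=> nu /orbit_nondegenerate [t _ ->]; exact: separating_stdfamily.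
Qed.

Lemma irreducible_sub_closure Y : subset_ Y AssSupVar -> zirreducible Y ->
  exists i : 'I_13, subset_ Y (zclosure (sorbit (Ralg i))).
Proof.
move=> YX irr.
have [||i _ sub] := @zirreducible_bigU _ (enum 'I_13) (fun i => zclosure (sorbit (Ralg i))) Y _ irr.
- by move=> i; exact: zclosure_closed.
- by move=> mu /YX /AssSupVar_cover [i hi]; exists i; rewrite ?mem_enum.
by exists i.
Qed.

Lemma closure_sub_AssSupVar (i : 'I_13) : subset_ (zclosure (sorbit (Ralg i))) AssSupVar.
Proof. exact: zclosure_min AssSupVar_closed (@orbit_sub_AssSupVar i). Qed.

Lemma zirr_componentP Y : zirr_component AssSupVar Y <->
  exists i : 'I_13, seteq_ Y (zclosure (sorbit (Ralg i))).
Proof.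
split=> [[YX [irr maxY]]|[i eY]].
  have [i sub] := irreducible_sub_closure YX irr.
  exists i => mu; split; first exact: sub.
  exact: maxY sub (@closure_sub_AssSupVar i) (@zirreducible_closure_orbit i) _.
have eY' : seteq_ (zclosure (sorbit (Ralg i))) Y by move=> mu; split=> /eY.
split; first by move=> mu /eY; exact: closure_sub_AssSupVar.
split; first exact: zirreducible_ext eY' (@zirreducible_closure_orbit i).
move=> Y' YY' Y'X irr' mu Y'mu; have [j sub] := irreducible_sub_closure Y'X irr'.
have [ji|ji] := eqVneq j i; first by apply/eY'; rewrite -ji; exact: sub.
by case: (Ralg_notin_closure ji); apply: sub; apply: YY'; apply/eY; apply: sub_zclosure;
  exact: sorbit_refl.
Qed.

(** If the orbit of [mu] is open and [mu] lies in the closure of O(R_i), the two orbits meet;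
    otherwise the closed complement would contain that closure. Conversely, within the variety the
    complement of O(R_i) is the union of the other twelve closures and the degenerate locus. *)
Lemma zrigidP mu : AssSupVar mu ->
  zrigid AssSupVar mu <-> exists i : 'I_13, sorbit (Ralg i) mu.
Proof.
move=> Xmu; split=> [[W [cW eW]]|[i Oi]].
  have [i Ci] := AssSupVar_cover Xmu.
  have [_ nW] := (eW mu).1 (sorbit_refl mu).
  exists i; apply: NNPP => nO; apply: nW; apply: zclosure_min Ci => // nu Onu.
  apply: NNPP => nW; apply: nO; apply: (sorbit_trans Onu); apply: sorbit_sym.
  by apply/eW; split=> //; exact: orbit_sub_AssSupVar Onu.
exists (fun nu => (exists2 j, j \in [seq j <- enum 'I_13 | j != i] & zclosure (sorbit (Ralg j)) nu)
  \/ degenerate i nu); split.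
  apply: zclosedU (degenerate_closed i).
  by apply: zclosed_bigU => j; exact: zclosure_closed.
move=> nu; split.
  move=> /(sorbit_trans Oi) Onu; split; first exact: orbit_sub_AssSupVar Onu.
  case=> [[j]|dg].
    rewrite mem_filter => /andP[ji _] Cj; apply: (Ralg_notin_closure ji).
    by apply: zclosure_sorbit Cj _; exact: sorbit_sym.
  by have [t nd nuE] := orbit_nondegenerate Onu; move: dg; rewrite nuE => /degenerateP.
move=> [/AssSupVar_family [j [t ->]] /not_or_and [nC nd]].
have ji : j = i.
  apply: NNPP => /eqP ji; apply: nC; exists j; last exact: stdfamily_closure.
  by rewrite mem_filter ji mem_enum.
subst j; apply: sorbit_trans (sorbit_sym Oi) _; apply: nondegenerate_orbit.
by apply: NNPP => h; apply: nd; apply/degenerateP.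
Qed.

(** * The dimension *)

(** The default 1, rather than 0, sets m = m' = 1. *)
Definition env5 (x : 'I_5 -> CC) : env := fun i => oapp x 1 (insub i).

Lemma env5E (g : nat -> CC) i : env5 (fun k : 'I_5 => g k) i = if (i < 5)%N then g i else 1.
Proof. by rewrite /env5; case: insubP => [k -> <-|/negPf ->]. Qed.

Lemma bounded_env5 F : pol F -> exists K, bounded_poly K (fun x => F (env5 x)).
Proof.
elim=> [c|i|G H _ [K hK] _ [L hL]|G H _ [K hK] _ [L hL]].
- by exists 0%N; exact: bp_const.
- exists 1%N; rewrite /env5; case: insubP => [k _ _|_]; first exact: bp_var.
  exact: bp_const.
- exists (maxn K L); apply: bp_add.
    by apply: bp_leq hK; exact: leq_maxl.
  by apply: bp_leq hL; exact: leq_maxr.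
- by exists (K + L)%N; exact: bp_mul.
Qed.

(* The comm_family parameters have two redundant scalings, which normalize m = m' = 1. *)
Lemma stdfamily_env5 (i : 'I_13) t : t 5%N <> 0 -> t 6%N <> 0 ->
  exists x, stdfamily i t = stdfamily i (env5 x).
Proof.
move=> /eqP t5 /eqP t6; case: (ltnP i 5) => hi; last first.
  exists (fun k : 'I_5 => t k).
  have E0 : t 0%N = env5 (fun k : 'I_5 => t k) 0%N by rewrite env5E.
  have E1 : t 1%N = env5 (fun k : 'I_5 => t k) 1%N by rewrite env5E.
  move: i hi; apply: (@ord13P (fun i => (5 <= i)%N -> stdfamily i t = stdfamily i _)) => // _;
  by rewrite /stdfamily /= /left_family /right_family -E0 -E1.
pose g := mkenv [:: t 0%N * t 5%N * t 6%N; t 1%N * t 5%N * t 6%N; t 2%N / t 5%N; t 3%N / t 6%N;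
  t 4%N * t 6%N].
exists (fun k : 'I_5 => g k).
have E u1 u2 v1 v2 k : comm_family u1 u2 v1 v2 k t =
    comm_family u1 u2 v1 v2 k (env5 (fun k : 'I_5 => g k)).
  rewrite /comm_family !env5E /g /mkenv /= /comm_mult.
  by congr mkeven; field; rewrite ?t5 ?t6.
by move: i hi; apply: (@ord13P (fun i => (i < 5)%N -> stdfamily i t = stdfamily i _)) => // _;
  exact: E.
Qed.

(** The relation among the six polynomials is found for normalized parameters. It then holds
    wherever m m' is nonzero, by density on the whole family, and so on its closure, contradicting
    independence on [Z]. *)
Lemma AssSupVar_dim_le : ~ irr_chain AssSupVar 6.
Proof.
move=> /irr_chain_indep [fs [Z [ZX irr sz [pfs ind]]]].
have [i Zi] := irreducible_sub_closure ZX irr.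
pose Psi x := stdfamily i (env5 x).
have pPsi := @polmap_stdfamily i.
have [||d d0 hd] := @bounded_dependent 5 [seq f \o Psi | f <- fs].
- by rewrite size_map.
- move=> k; have [kfs|kfs] := ltnP k (size fs).
    rewrite (nth_map (fun=> 0)) //.
    exact: bounded_env5 (pol_comp (pfs k kfs) pPsi).
  by exists 0%N; rewrite nth_default ?size_map //; exact: bp_zero.
rewrite sz in ind; have [mu Zmu] := ind d d0; apply.
have pd : polyfun (ceval d fs) by exact: polyfun_ceval.
apply: (proj2 (closure_orbit_image i mu) (Zi _ Zmu)) => // _ [t ->].
apply: NNPP => nz.
have pg : pol (fun t => t 5%N * t 6%N) by apply: pol_mul; exact: pol_var.
have g1 : (fun t : env => t 5%N * t 6%N) (fun=> 1) <> 0 by rewrite /= mulr1; apply/eqP/oner_neq0.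
have [t'] := pol_mul_neq0 (b := fun=> 1) (pol_comp pd pPsi) pg nz g1; apply.
have [t5|t5] := classic (t' 5%N = 0); first by rewrite t5 mul0r mulr0.
have [t6|t6] := classic (t' 6%N = 0); first by rewrite t6 !mulr0.
have [x E] := stdfamily_env5 i t5 t6.
by have := hd x; rewrite ceval_map /Psi /= E => ->; rewrite mul0r.
Qed.

(* The flag {0} < line < plane < nilpotent even part < L = 0 < everything, inside the component of R_03. *)
Definition flag (k : nat) (t : env) : env :=
  nth id
  [:: fun _ => mkenv [::];
      fun t => mkenv [:: 0; 0; t 3%N; t 3%N; t 4%N; 0; 0];
      fun t => mkenv [:: 0; 0; t 3%N; t 3%N; t 4%N; t 6%N; t 6%N];
      fun t => mkenv [:: t 0%N * t 6%N; t 0%N * t 3%N; t 3%N; t 3%N; t 4%N; t 6%N; t 6%N];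
      fun t => mkenv [:: t 0%N * t 6%N; t 0%N * t 3%N; t 2%N; t 3%N; t 4%N; t 5%N; t 6%N]] k t.

Lemma pol_subst F (psi : env -> env) :
  pol F -> (forall i, pol (fun t => psi t i)) -> pol (F \o psi).
Proof.
move=> pF hpsi; elim: pF => /= [c|i|G H _ IHG _ IHH|G H _ IHG _ IHH].
- exact: pol_const.
- exact: hpsi.
- exact: pol_add IHG IHH.
- exact: pol_mul IHG IHH.
Qed.

Lemma pol_flag k i : pol (fun t => flag k t i).
Proof.
rewrite /flag /mkenv.
case: k => [|[|[|[|[|k]]]]]; case: i => [|[|[|[|[|[|[|i]]]]]]] /=; rewrite ?nth_nil;
  repeat first [exact: pol_var | exact: pol_const | apply: pol_mul].
Qed.

Lemma flag_succ k t : exists t', flag k t = flag k.+1 t'.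
Proof.
have mkenv_eq s s' : (forall i, (i < 7)%N -> s`_i = s'`_i) -> (size s <= 7)%N -> (size s' <= 7)%N ->
    mkenv s = mkenv s'.
  move=> h hs hs'; apply: functional_extensionality => i; rewrite /mkenv.
  by case: (ltnP i 7) => hi; [exact: h | rewrite !nth_default // (leq_trans _ hi)].
case: k => [|[|[|[|[|k]]]]].
- by exists (mkenv [::]); apply: mkenv_eq => //; do 7 case=> //.
- by exists (mkenv [:: 0; 0; 0; t 3%N; t 4%N; 0; 0]).
- exists (mkenv [:: 0; 0; 0; t 3%N; t 4%N; 0; t 6%N]).
  by rewrite /flag /mkenv /= !mul0r.
- by exists (mkenv [:: t 0%N; 0; t 3%N; t 3%N; t 4%N; t 6%N; t 6%N]).
(* From stage 5 on the default [id] applies, so stage 5 is the whole family. *)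
- by exists (flag 4 t).
- by exists t; rewrite /flag !nth_default.
Qed.

(** The separating functions are, in turn, the two coordinates of the odd square (the second up to
    sign), a coefficient of e_1 e_1, the trace of left multiplication by e_1, which vanishes on
    nilpotent even parts, and l_1, a coordinate of L. *)
Lemma flag_strict k : (k < 5)%N -> exists g, [/\ polyfun g,
  forall t, g (stdfamily 1 (flag k t)) = 0 & exists t, g (stdfamily 1 (flag k.+1 t)) <> 0].
Proof.
have pt : polyfun (fun mu => mu o0 o0 o0 + mu o0 o1 o1) by apply: pf_add; exact: pf_coord.
have ne1 (x : CC) : x = 1 -> x <> 0 by move=> ->; apply/eqP/oner_neq0.
case: k => [|[|[|[|[|//]]]]] _.
- exists (fun mu => mu o2 o2 o0); split; first exact: pf_coord.
    by move=> t; rewrite /flag /stdfamily /= /comm_family /comm_mult /mkeven /mkenv /=; ring.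
  by exists (fun=> 1); apply: ne1; rewrite /flag /stdfamily /= /comm_family /comm_mult /mkeven /mkenv /=; ring.
- exists (fun mu => - mu o2 o2 o1); split; first by apply: polyfun_opp; exact: pf_coord.
    by move=> t; rewrite /flag /stdfamily /= /comm_family /comm_mult /mkeven /mkenv /=; ring.
  by exists (fun=> 1); apply: ne1; rewrite /flag /stdfamily /= /comm_family /comm_mult /mkeven /mkenv /=; ring.
- exists (fun mu => mu o0 o0 o1); split; first exact: pf_coord.
    by move=> t; rewrite /flag /stdfamily /= /comm_family /comm_mult /mkeven /mkenv /=; ring.
  by exists (fun=> 1); apply: ne1; rewrite /flag /stdfamily /= /comm_family /comm_mult /mkeven /mkenv /=; ring.
- exists (fun mu => mu o0 o0 o0 + mu o0 o1 o1); split=> //.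
    by move=> t; rewrite /flag /stdfamily /= /comm_family /comm_mult /mkeven /mkenv /=; ring.
  exists (mkenv [:: 1; 0; 0; 1; 0; 1; 1]).
  by apply: ne1; rewrite /flag /stdfamily /= /comm_family /comm_mult /mkeven /mkenv /=; ring.
- exists (fun mu => mu o0 o2 o2); split; first exact: pf_coord.
    by move=> t; rewrite /flag /stdfamily /= /comm_family /comm_mult /mkeven /mkenv /=; ring.
  exists (mkenv [:: 0; 1; 0; 0; 0; 1; 1]).
  by apply: ne1; rewrite /flag /stdfamily /= /comm_family /comm_mult /mkeven /mkenv /=; ring.
Qed.

Lemma AssSupVar_dim_ge : irr_chain AssSupVar 5.
Proof.
pose Phi k t := stdfamily 1 (flag k t); pose i1 := @Ordinal 13 1 isT.
exists (fun k => zclosure (image_of (Phi k))); split=> k hk.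
  split; last first.
    apply: zirreducible_image => a b c.
    exact: (pol_subst (@polmap_stdfamily i1 a b c) (pol_flag k)).
  exists (zclosure (image_of (Phi k))); split; first exact: zclosure_closed.
  move=> mu; split=> [h|[]//]; split=> //.
  apply: zclosure_min h; first exact: AssSupVar_closed.
  by move=> _ [t ->]; exact: (@stdfamily_assoc i1).
split.
  apply: zclosure_min; first exact: zclosure_closed.
  move=> _ [t ->]; apply: sub_zclosure; have [t' E] := flag_succ k t.
  by exists t'; rewrite /Phi E.
have [g [pg g0 [t gt]]] := flag_strict hk.
exists (Phi k.+1 t); split; first by apply: sub_zclosure; exists t.
by move=> h; apply: gt; apply: h => // _ [t' ->]; exact: g0.
Qed.

Theorem mainTheorem10 :
  has_dim AssSupVar 5 /\
  (forall Y : pset, zirr_component AssSupVar Y <->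
     exists n : 'I_13, seteq_ Y (closure_in AssSupVar (sorbit (Ralg n)))) /\
  (forall n m : 'I_13, n != m ->
     ~ seteq_ (closure_in AssSupVar (sorbit (Ralg n)))
              (closure_in AssSupVar (sorbit (Ralg m)))) /\
  (forall n m : 'I_13, n != m -> ~ sorbit (Ralg n) (Ralg m)) /\
  (forall mu : struct, AssSupVar mu ->
     (zrigid AssSupVar mu <-> exists n : 'I_13, sorbit (Ralg n) mu)).
Proof.
split; first by split; [exact: AssSupVar_dim_ge | exact: AssSupVar_dim_le].
split.
  move=> Y; split=> [/zirr_componentP [n E]|[n E]]; last apply/zirr_componentP.
    by exists n => mu; split=> [/E|] h; [apply/closure_orbitE | apply/E/closure_orbitE].
  by exists n => mu; split=> [/E|] h; [apply/closure_orbitE | apply/E/closure_orbitE].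
split.
  move=> n m nm E; apply: (Ralg_notin_closure nm); apply/closure_orbitE; apply/E.
  by apply/closure_orbitE; apply: sub_zclosure; exact: sorbit_refl.
split; last exact: zrigidP.
by move=> n m nm h; apply: (Ralg_notin_closure nm); exact: sub_zclosure.
Qed.
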